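(* Let $M$ be a finitely generated abelian conical monoid. Then there exist a zero-dimensional metrizable compact space $Z$ and a global action of a finitely generated free group $\mathbb F$ on $Z$ (by homeomorphisms) such that there is an order-embedding $\iota\colon M\to S(Z,\mathbb F,\mathbb K(Z))$.
   Context: A monoid is conical if $a+b=0$ implies $a=b=0$. On an abelian monoid, $\le$ is the algebraic preorder ($x\le y$ iff $x+z=y$ for some $z$). An order-embedding is an injective monoid homomorphism $\iota$ such that $\iota(x)\le\iota(y)$ if and only if $x\le y$. $\mathbb K(Z)$ is the algebra of clopen subsets of $Z$. For an action $\theta$ of a group $G$ on $Z$ by homeomorphisms, the type semigroup $S(Z,G,\mathbb K(Z))$ is the set of classes $[A]$ of sets $A=\bigcup_{i=1}^nA_i\times\{i\}$, $A_i\in\mathbb K(Z)$, $n\in\mathbb N$, where $A\sim B$ iff there are $l\in\mathbb N$, $C_k\in\mathbb K(Z)$, $t_k\in G$, $n_k,m_k\in\mathbb N$ ($1\le k\le l$) with $A=\bigsqcup_kC_k\times\{n_k\}$ and $B=\bigsqcup_k\theta_{t_k}(C_k)\times\{m_k\}$. Addition: $[\bigcup_{i\le n}A_i\times\{i\}]+[\bigcup_{j\le m}B_j\times\{j\}]=[\bigcup_{i\le n}A_i\times\{i\}\cup\bigcup_{j\le m}B_j\times\{n+j\}]$. *)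

(* Defs.v *)
From HB Require Import structures.
From mathcomp Require Import all_boot all_order all_algebra generic_quotient.
From mathcomp Require Import all_classical all_reals all_analysis.

Set Implicit Arguments.
Unset Strict Implicit.
Unset Printing Implicit Defensive.

Import Order.TTheory GRing.Theory Num.Theory.

Local Open Scope classical_set_scope.
Local Open Scope quotient_scope.
Local Open Scope ring_scope.

Definition conical (M : nmodType) : Prop :=
  forall a b : M, a + b = 0 -> a = 0 /\ b = 0.

Definition finitely_generated (M : nmodType) : Prop :=
  exists s : seq M, forall x : M, exists k : nat -> nat,
    x = \sum_(i < size s) s`_i *+ k i.

Definition alg_le (M : nmodType) (x y : M) : Prop := exists z : M, x + z = y.

Definition order_embedding (M N : nmodType) (f : {additive M -> N}) : Prop :=
  injective f /\ forall x y : M, alg_le (f x) (f y) <-> alg_le x y.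

(* Universal property of the free group on [b]. *)
Definition free_basis (I : Type) (F : groupType) (b : I -> F) : Prop :=
  forall (H : groupType) (h : I -> H),
    (exists phi : {multiplicative F -> H}, forall i, phi (b i) = h i) /\
    (forall phi psi : {multiplicative F -> H},
       (forall i, phi (b i) = h i) -> (forall i, psi (b i) = h i) ->
       forall g, phi g = psi g).

Definition fg_free_group (F : groupType) : Prop :=
  exists (r : nat) (b : 'I_r -> F), free_basis b.

(* [act g] is a homeomorphism, since [act g^-1] is its continuous inverse. *)
Record homeo_action (G : groupType) (Z : topologicalType) := HomeoAction {
  act :> G -> Z -> Z;
  act1 : forall z, act 1%g z = z;
  actM : forall g h z, act (g * h)%g z = act g (act h z);
  act_continuous : forall g, continuous (act g)
}.

Section HomeoActionTheory.
Variables (G : groupType) (Z : topologicalType) (theta : homeo_action G Z).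

Lemma actK g : cancel (theta g) (theta g^-1%g).
Proof. by move=> z; rewrite -actM mulVg act1. Qed.

Lemma actVK g : cancel (theta g^-1%g) (theta g).
Proof. by move=> z; rewrite -actM mulgV act1. Qed.

Lemma act_image g (C : set Z) : theta g @` C = theta g^-1%g @^-1` C.
Proof.
apply/seteqP; split => z /=; first by move=> [y Cy <-]; rewrite actK.
by move=> Cz; exists (theta g^-1%g z) => //; rewrite actVK.
Qed.

Lemma act_clopen g (C : set Z) : clopen C -> clopen (theta g @` C).
Proof.
move=> cC; rewrite act_image; apply: preimage_clopen => //.
exact: act_continuous.
Qed.

End HomeoActionTheory.

(* The library's [zero_dimensional] asks that clopen sets separate points; on
   compact Hausdorff spaces this is the existence of a base of clopen sets. *)
Lemma zero_dimensional_base (Z : topologicalType) :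
  hausdorff_space Z -> compact [set: Z] ->
  zero_dimensional Z <->
  forall (z : Z) (U : set Z), nbhs z U ->
    exists V : set Z, [/\ clopen V, V z & V `<=` U].
Proof.
move=> hZ cZ; split=> [zd z U zU|base x y xy].
  have [V [Vz cV] VU] := zero_dimensional_cvg hZ zd cZ zU.
  by exists V; split.
have [U [yU nx]] : exists U, nbhs x U /\ ~ U y.
  move/eqP: xy => xy; apply: contrapT => nU; apply: xy; apply: hZ => A B xA yB.
  exists y; split; last exact: nbhs_singleton.
  by apply: contrapT => nAy; apply: nU; exists A.
have [V [cV Vx VU]] := base x U yU.
by exists V; split => // /VU.
Qed.

Record clopen_algebra (Z : topologicalType) := ClopenAlgebra {
  clopen_set :> set Z;
  clopen_setP : clopen clopen_set
}.

HB.instance Definition _ (Z : topologicalType) := gen_eqMixin (clopen_algebra Z).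
HB.instance Definition _ (Z : topologicalType) :=
  gen_choiceMixin (clopen_algebra Z).

(* The sequence [A_0; ...; A_(n-1)] stands for the union of the A_i x {i};
   levels are numbered from 0. *)
Definition level_set (Z : topologicalType) (s : seq (clopen_algebra Z)) :
    set (Z * nat) :=
  \bigcup_(i in [set: 'I_(size s)])
    ((tnth (in_tuple s) i : set Z) `*` [set (i : nat)]).

Definition equidecomposable (G : groupType) (Z : topologicalType)
    (theta : homeo_action G Z) (A B : set (Z * nat)) : Prop :=
  exists (l : nat) (C : 'I_l -> clopen_algebra Z) (t : 'I_l -> G)
         (n m : 'I_l -> nat),
    [/\ trivIset [set: 'I_l] (fun k => C k `*` [set n k]),
        A = \bigcup_(k in [set: 'I_l]) (C k `*` [set n k]),
        trivIset [set: 'I_l] (fun k => (theta (t k) @` C k) `*` [set m k])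
      & B = \bigcup_(k in [set: 'I_l]) ((theta (t k) @` C k) `*` [set m k])].

Section TypeSemigroup.
Variables (G : groupType) (Z : topologicalType) (theta : homeo_action G Z).
Implicit Types (A B : set (Z * nat)) (s : seq (clopen_algebra Z)).

Let eqd := equidecomposable theta.

Let setI_cst_clopen (b : bool) (C D : set Z) :
  clopen C -> clopen D -> clopen [set z | b /\ C z /\ D z].
Proof.
move=> cC cD; case: b; last first.
  rewrite (_ : mkset _ = set0); first exact: clopen0.
  by apply/seteqP; split => z // [].
rewrite (_ : mkset _ = C `&` D); first exact: clopenI.
by apply/seteqP; split => z //= [].
Qed.

Let eqdP (I : finType) (C : I -> set Z) (t : I -> G) (n m : I -> nat) A B :
  (forall k, clopen (C k)) ->
  (forall k k' z, C k z -> C k' z -> n k = n k' -> k = k') ->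
  (forall z i, A (z, i) <-> exists2 k, C k z & i = n k) ->
  (forall k k' z z', C k z -> C k' z' -> theta (t k) z = theta (t k') z' ->
     m k = m k' -> k = k') ->
  (forall z i, B (z, i) <-> exists2 k, (theta (t k) @` C k) z & i = m k) ->
  eqd A B.
Proof.
move=> cC dA defA dB defB.
exists #|I|, (fun k => ClopenAlgebra (cC (enum_val k))),
  (t \o enum_val), (n \o enum_val), (m \o enum_val); split.
- move=> k k' _ _ [[z i] [/= [Cz ->] [Cz' e]]].
  by apply: enum_val_inj; exact: dA Cz Cz' e.
- apply/seteqP; split => -[z i].
    by move=> /defA [k Ckz ->]; exists (enum_rank k) => //=; rewrite enum_rankK.
  by move=> [k _ [/= Ckz ->]]; apply/defA; exists (enum_val k).
- move=> k k' _ _ [[z i] [/= [[y Cy <-] ->] [[y' Cy' e'] e]]].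
  by apply: enum_val_inj; exact: dB Cy Cy' (esym e') e.
- apply/seteqP; split => -[z i].
    by move=> /defB [k Ckz ->]; exists (enum_rank k) => //=; rewrite enum_rankK.
  by move=> [k _ [/= Ckz ->]]; apply/defB; exists (enum_val k).
Qed.

Let eqdE A B : eqd A B -> exists (l : nat) (C : 'I_l -> set Z) (t : 'I_l -> G)
         (n m : 'I_l -> nat),
  [/\ forall k, clopen (C k),
  forall k k' z, C k z -> C k' z -> n k = n k' -> k = k',
  forall z i, A (z, i) <-> exists2 k, C k z & i = n k,
  forall k k' z z', C k z -> C k' z' -> theta (t k) z = theta (t k') z' ->
     m k = m k' -> k = k' &
  forall z i, B (z, i) <-> exists2 k, (theta (t k) @` C k) z & i = m k].
Proof.
move=> [l [C [t [n [m [dA -> dB ->]]]]]].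
exists l, C, t, n, m; split.
- by move=> k; exact: clopen_setP.
- by move=> k k' z Cz Cz' e; apply: dA => //; exists (z, n k); split; split.
- move=> z i; split=> [[k _ [/= Cz ->]]|[k Cz ->]]; first by exists k.
  by exists k.
- move=> k k' z z' Cz Cz' e e'; apply: dB => //.
  exists (theta (t k) z, m k); split; split => //=; first by exists z.
  by exists z'.
- move=> z i; split=> [[k _ [/= Cz ->]]|[k Cz ->]]; first by exists k.
  by exists k.
Qed.

Let level_setE s z i : level_set s (z, i) <->
  exists k : 'I_(size s), (tnth (in_tuple s) k : set Z) z /\ i = k.
Proof.
by split=> [[k _ [/= Cz ->]]|[k [Cz ->]]]; exists k.
Qed.

Lemma equidecomposable_refl s : eqd (level_set s) (level_set s).
Proof.
apply: (@eqdP 'I_(size s) (fun k => tnth (in_tuple s) k : set Z) (fun=> 1%g)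
  (fun k => k) (fun k => k)).
- by move=> k; exact: clopen_setP.
- by move=> k k' z _ _ /ord_inj.
- by move=> z i; rewrite level_setE; split=> -[k]; [case=> ? ?|move=> ? ?]; exists k.
- by move=> k k' z z' _ _ _ /ord_inj.
- move=> z i; rewrite level_setE; split=> [[k [Cz ->]]|[k [y Cy <-] ->]].
    by exists k => //; exists z => //; rewrite act1.
  by exists k; rewrite act1.
Qed.

Lemma equidecomposable_sym A B : eqd A B -> eqd B A.
Proof.
move=> /eqdE [l [C [t [n [m [cC dA defA dB defB]]]]]].
apply: (@eqdP 'I_l (fun k => theta (t k) @` C k) (fun k => (t k)^-1%g) m n).
- by move=> k; exact: act_clopen.
- move=> k k' z [y Cy yz] [y' Cy' yz'] e.
  by apply: (dB _ _ _ _ Cy Cy') => //; rewrite yz yz'.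
- exact: defB.
- move=> k k' _ _ [y Cy <-] [y' Cy' <-]; rewrite !actK => yy' e.
  by apply: (dA _ _ y) => //; rewrite yy'.
- move=> z i; rewrite defA; split=> [[k Cz ->]|[k [_ [y Cy <-] <-] ->]].
    by exists k => //; exists (theta (t k) z); [exists z|rewrite actK].
  by exists k => //; rewrite actK.
Qed.

Lemma equidecomposable_trans A B D : eqd A B -> eqd B D -> eqd A D.
Proof.
move=> /eqdE [l [C [t [n [m [cC dA defA dB defB]]]]]].
move=> /eqdE [l' [C' [t' [n' [m' [cC' dB' defB' dD defD]]]]]].
pose E (k : 'I_l * 'I_l') : set Z :=
  [set z | m k.1 == n' k.2 /\ C k.1 z /\ C' k.2 (theta (t k.1) z)].
apply: (@eqdP ('I_l * 'I_l')%type E (fun k => t' k.2 * t k.1)%g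
  (fun k => n k.1) (fun k => m' k.2)).
- move=> k; apply: setI_cst_clopen => //.
  exact: (preimage_clopen (cC' _) (@act_continuous _ _ theta (t k.1))).
- move=> [k j] [k' j'] z [/= /eqP e1 [Ck Cj]] [/= /eqP e2 [Ck' Cj']] e.
  have kk := dA _ _ _ Ck Ck' e; subst k'; congr (_, _).
  by apply: (dB' _ _ _ Cj Cj'); rewrite -e1 -e2.
- move=> z i; rewrite defA; split=> [[k Cz ->]|[[k j] [/= _ [Cz _]] ->]].
    have /defB' [j C'j e] : B (theta (t k) z, m k).
      by apply/defB; exists k => //; exists z.
    by exists (k, j) => //=; split; [apply/eqP|].
  by exists k.
- move=> [k j] [k' j'] z z' [/= /eqP e1 [Ck Cj]] [/= /eqP e2 [Ck' Cj']].
  rewrite !actM => ez e.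
  have jj := dD _ _ _ _ Cj Cj' ez e; subst j'; congr (_, _).
  apply: (dB _ _ _ _ Ck Ck'); last by rewrite e1 e2.
  exact: (can_inj (actK theta (t' j))).
- move=> z i; rewrite defD; split=> [[j [y Cy <-] ->]|].
    have /defB [k [x Ckx xy] e] : B (y, n' j) by apply/defB'; exists j.
    exists (k, j) => //=; exists x => //; last by rewrite actM xy.
    by split; [rewrite /= e|rewrite /= xy].
  move=> [[k j] [y [/= _ [Cy C'y]] <-] ->]; exists j => //.
  by rewrite actM; exists (theta (t k) y).
Qed.

Let eqdU A B A' B' : A `&` B = set0 -> A' `&` B' = set0 ->
  eqd A A' -> eqd B B' -> eqd (A `|` B) (A' `|` B').
Proof.
move=> AB AB' /eqdE [l [C [t [n [m [cC dA defA dA' defA']]]]]].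
move=> /eqdE [l' [D [u [p [q [cD dB defB dB' defB']]]]]].
have disj z i : A (z, i) -> B (z, i) -> False.
  by move=> Az Bz; have : (A `&` B) (z, i) by []; rewrite AB.
have disj' z i : A' (z, i) -> B' (z, i) -> False.
  by move=> Az Bz; have : (A' `&` B') (z, i) by []; rewrite AB'.
pose join T (f : 'I_l -> T) (g : 'I_l' -> T) (k : 'I_l + 'I_l') :=
  match k with inl a => f a | inr b => g b end.
apply: (@eqdP ('I_l + 'I_l')%type (join _ C D) (join _ t u) (join _ n p)
  (join _ m q)).
- by case.
- move=> [a|b] [a'|b'] z /= Cz Cz' e.
  + by rewrite (dA _ _ _ Cz Cz' e).
  + by case: (disj z (n a)); [apply/defA; exists a|apply/defB; exists b'].
  + by case: (disj z (p b)); [apply/defA; exists a'|apply/defB; exists b].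
  + by rewrite (dB _ _ _ Cz Cz' e).
- move=> z i; split=> [[/defA [k Ck ->]|/defB [k Ck ->]]|[[k|k] /= Ck ->]].
  + by exists (inl k).
  + by exists (inr k).
  + by left; apply/defA; exists k.
  + by right; apply/defB; exists k.
- move=> [a|b] [a'|b'] z z' /= Cz Cz' ez e.
  + by rewrite (dA' _ _ _ _ Cz Cz' ez e).
  + case: (disj' (theta (t a) z) (m a)).
      by apply/defA'; exists a => //; exists z.
    by apply/defB'; exists b' => //; exists z'.
  + case: (disj' (theta (u b) z) (q b)).
      by apply/defA'; exists a' => //; exists z'.
    by apply/defB'; exists b => //; exists z.
  + by rewrite (dB' _ _ _ _ Cz Cz' ez e).
- move=> z i; split=> [[/defA' [k Ck ->]|/defB' [k Ck ->]]|[[k|k] /= Ck ->]].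
  + by exists (inl k).
  + by exists (inr k).
  + by left; apply/defA'; exists k.
  + by right; apply/defB'; exists k.
Qed.

Let shift (c : nat) A : set (Z * nat) :=
  [set p | (c <= p.2)%N /\ A (p.1, p.2 - c)%N].

Let eqd_shift c d A B : eqd A B -> eqd (shift c A) (shift d B).
Proof.
move=> /eqdE [l [C [t [n [m [cC dA defA dB defB]]]]]].
apply: (@eqdP 'I_l C t (fun k => c + n k)%N (fun k => d + m k)%N) => //.
- by move=> k k' z Cz Cz' /addnI; exact: dA Cz Cz'.
- move=> z i; rewrite /shift /= defA; split=> [[ci [k Cz e]]|[k Cz ->]].
    by exists k => //; rewrite -e subnKC.
  by rewrite leq_addr addKn; split => //; exists k.
- by move=> k k' z z' Cz Cz' ez /addnI; exact: dB Cz Cz' ez.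
- move=> z i; rewrite /shift /= defB; split=> [[ci [k Cz e]]|[k Cz ->]].
    by exists k => //; rewrite -e subnKC.
  by rewrite leq_addr addKn; split => //; exists k.
Qed.

Let shift0 A : shift 0 A = A.
Proof.
by apply/seteqP; split => -[z i]; rewrite /shift /= subn0 // => -[].
Qed.

Let level_set_nth s z i : level_set s (z, i) <->
  (i < size s)%N /\ (nth (ClopenAlgebra clopen0) s i : set Z) z.
Proof.
rewrite level_setE; split=> [[k [Cz ->]]|[lt_i Cz]].
  by split => //; move: Cz; rewrite (tnth_nth (ClopenAlgebra clopen0)).
by exists (Ordinal lt_i); rewrite (tnth_nth (ClopenAlgebra clopen0)).
Qed.

Lemma level_set_cat s s' :
  level_set (s ++ s') = level_set s `|`
    [set p | (size s <= p.2)%N /\ level_set s' (p.1, p.2 - size s)%N].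
Proof.
apply/seteqP; split => -[z i].
  move=> /level_set_nth; rewrite size_cat nth_cat => -[].
  case: (ltnP i (size s)) => [lt_i _ Cz|le_i lt_i Cz].
    by left; apply/level_set_nth.
  right; split=> //=; apply/level_set_nth; split => //.
  by rewrite ltn_subLR.
move=> [/level_set_nth [lt_i Cz]|[/= le_i /level_set_nth [lt_i Cz]]].
  by apply/level_set_nth; rewrite size_cat nth_cat lt_i ltn_addr.
apply/level_set_nth; rewrite size_cat nth_cat -ltn_subLR //.
by rewrite [(i < size s)%N]ltnNge le_i.
Qed.

Let level_set_shift_disj s A : level_set s `&` shift (size s) A = set0.
Proof.
apply/seteqP; split => -[z i] // [/level_set_nth [lt_i _] [/= le_i _]].
by move: lt_i; rewrite ltnNge le_i.
Qed.

Definition level_equiv s s' : bool :=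
  `[< equidecomposable theta (level_set s) (level_set s') >].

Lemma level_equiv_refl : reflexive level_equiv.
Proof. by move=> s; apply/asboolP/equidecomposable_refl. Qed.

Lemma level_equiv_sym : symmetric level_equiv.
Proof.
by move=> s s'; apply/idP/idP => /asboolP h; apply/asboolP;
  exact: equidecomposable_sym.
Qed.

Lemma level_equiv_trans : transitive level_equiv.
Proof.
by move=> s2 s1 s3 /asboolP h1 /asboolP h2; apply/asboolP;
  exact: equidecomposable_trans h1 h2.
Qed.

Canonical level_equiv_rel :=
  EquivRel level_equiv level_equiv_refl level_equiv_sym level_equiv_trans.

Lemma level_equiv_cat s1 s1' s2 s2' : level_equiv s1 s1' ->
  level_equiv s2 s2' -> level_equiv (s1 ++ s2) (s1' ++ s2').
Proof.
move=> /asboolP h1 /asboolP h2; apply/asboolP; rewrite !level_set_cat.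
apply: eqdU => //; last exact: eqd_shift.
all: exact: level_set_shift_disj.
Qed.

Lemma level_equiv_catC s1 s2 : level_equiv (s1 ++ s2) (s2 ++ s1).
Proof.
apply/asboolP; rewrite !level_set_cat [X in equidecomposable _ _ X]setUC.
apply: eqdU.
- exact: level_set_shift_disj.
- by rewrite setIC; exact: level_set_shift_disj.
- by rewrite -{1}[level_set s1]shift0; apply: eqd_shift; exact: equidecomposable_refl.
- by rewrite -{2}[level_set s2]shift0; apply: eqd_shift; exact: equidecomposable_refl.
Qed.

(* S(Z, G, K(Z)): a class of level sets is represented by the class of the
   sequences presenting them; sequences with the same level set are equivalent. *)
Definition type_semigroup : Type := {eq_quot level_equiv_rel}.

HB.instance Definition _ := Choice.on type_semigroup.
HB.instance Definition _ := EqQuotient.on type_semigroup.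

Definition type_class s : type_semigroup := \pi_type_semigroup s.

Lemma type_classP s s' : type_class s = type_class s' <->
  equidecomposable theta (level_set s) (level_set s').
Proof.
rewrite /type_class; split=> [/eqmodP/asboolP //|h].
by apply/eqmodP/asboolP.
Qed.

(* Concatenation moves the levels of the second summand above those of the
   first. *)
Definition type_add (x y : type_semigroup) : type_semigroup :=
  type_class (repr x ++ repr y).

Lemma type_addE s s' :
  type_add (type_class s) (type_class s') = type_class (s ++ s').
Proof.
rewrite /type_add /type_class; apply/eqmodP; apply: level_equiv_cat.
  by have /eqmodP := reprK (\pi_type_semigroup s).
by have /eqmodP := reprK (\pi_type_semigroup s').
Qed.

Let type_classE (x : type_semigroup) : x = type_class (repr x).
Proof. by rewrite /type_class reprK. Qed.

Lemma type_addA : associative type_add.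
Proof.
move=> x y z; rewrite (type_classE x) (type_classE y) (type_classE z).
by rewrite !type_addE catA.
Qed.

Lemma type_addC : commutative type_add.
Proof.
move=> x y; rewrite (type_classE x) (type_classE y) !type_addE.
by apply/eqmodP; exact: level_equiv_catC.
Qed.

Lemma type_add0 : left_id (type_class [::]) type_add.
Proof. by move=> x; rewrite (type_classE x) type_addE. Qed.

HB.instance Definition _ :=
  GRing.isNmodule.Build type_semigroup type_addA type_addC type_add0.

End TypeSemigroup.

(* Main.v *)
Require Import Defs.
From HB Require Import structures.
From mathcomp Require Import all_boot all_order all_algebra.
From mathcomp Require Import generic_quotient perm.
From mathcomp Require Import all_classical all_reals all_analysis.
From mathcomp Require Import zify.

Set Implicit Arguments.
Unset Strict Implicit.
Unset Printing Implicit Defensive.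

Import Order.TTheory GRing.Theory Num.Theory.

Local Open Scope classical_set_scope.

(** A finitely generated commutative monoid is finitely presented ([redei]), and
    if it is conical the presentation can be put in a dynamical form
    ([pairing_presentation]): a finite alphabet, and for each index [d] in a
    finite set a partition of the alphabet into blocks, the blocks being matched
    in pairs (or with themselves); the only relations say that a block and its
    partner have the same sum.

    Such a [pairing_system] asks for a compact space coloured by the alphabet and
    for involutions indexed by [d] that exchange the set of points coloured in a
    block with the set of points coloured in the partner block. In the type
    semigroup of the group generated by the involutions the relations of the
    monoid then hold, so sending a letter to the class of the set of points with
    that colour is a homomorphism. The point is to choose the space so free that
    nothing else holds. Refine the alphabet: a new letter is a star, that is a
    letter together with the colours of the images of a point under all the
    involutions. The stars form again a pairing system. The space is the inverse
    limit of the iterated refinements. It is a compact ultrametric space, and a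
    star at level [n.+1] announces the images at level [n], so the involutions
    are determined on the limit. The free group acts through them; in particular
    its action is defined on the whole space.

    Two equidecomposable clopen sets are decided, together with all the pieces
    of the decomposition and their translates, at some finite level, where the
    decomposition becomes a congruence of multisets of letters
    ([equidecomposable_height]). Everything thus rests on one step of the
    refinement: replacing each letter by the sum of its stars must reflect
    equality and the algebraic preorder ([star_lift_inj], [star_lift_descent]).
    This is proved with an invariant, [descends]. Call slice the set of stars
    with a given centre and a given neighbour in one direction. Each generating
    relation between stars exchanges a slice with the slice obtained by
    exchanging centre and neighbour. A multiset of stars congruent to the lift
    of [v] remains a sum of slices whose total coefficients on each edge are
    those of a multiset of letters congruent to [v], and whenever such a multiset
    contains all the stars at a letter, that letter can be subtracted on both
    sides. *)

(** * Pairing systems and their refinement by stars *)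

(** A finite alphabet with, for each index [d], a matching of blocks of letters:
    by [edge_block] the relation [edge d] is complete between the block of [a]
    and its partner block. A point coloured [a] may be sent by the [d]-th
    involution to a point of any colour in the partner block, and to no other. *)
Record pairing_system (D : Type) := PairingSystem {
  letter :> finType;
  edge : D -> rel letter;
  edge_sym : forall d, symmetric (edge d);
  edge_block : forall d a a' b b',
    edge d a b -> edge d a' b -> edge d a' b' -> edge d a b';
  edge_total : forall d a, exists b, edge d a b
}.

Section Congruence.
Variables (D : Type) (S : pairing_system D).
Implicit Types (u v w : S -> nat) (d : D) (a b c : S).

(** The congruence on multisets of letters that identifies each block with its
    partner. It is generated by one-sided steps because [edge_sym] makes the
    reverse of a step a step. *)
Inductive cgr u : (S -> nat) -> Prop :=
| cgr_refl : cgr u u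
| cgr_step w d a b : edge d a b ->
    cgr u (fun c => w c + edge d a c) -> cgr u (fun c => w c + edge d b c).

Lemma cgr_ext u u' v v' : u =1 u' -> v =1 v' -> cgr u v -> cgr u' v'.
Proof. by move=> /funext <- /funext <-. Qed.

Lemma cgr_trans v u w : cgr u v -> cgr v w -> cgr u w.
Proof.
by move=> uv; elim=> // {}w d a b ab _; exact: cgr_step.
Qed.

Lemma cgr_sym u v : cgr u v -> cgr v u.
Proof.
elim=> [|w d a b ab _ IH]; first exact: cgr_refl.
apply: cgr_trans IH; apply: (@cgr_step _ w d b a); first by rewrite edge_sym.
exact: cgr_refl.
Qed.

Lemma cgr_addr w u v : cgr u v ->
  cgr (fun c => u c + w c) (fun c => v c + w c).
Proof.
elim=> [|{}v d a b ab _ IH]; first exact: cgr_refl.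
apply: (@cgr_ext _ _ (fun c => (v c + w c) + edge d b c)) => [//|c|].
  by rewrite addnAC.
by apply: cgr_step ab _; apply: cgr_ext IH => // c; rewrite addnAC.
Qed.

Lemma cgr_add u v u' v' : cgr u v -> cgr u' v' ->
  cgr (fun c => u c + u' c) (fun c => v c + v' c).
Proof.
move=> uv uv'; apply: (cgr_trans (cgr_addr u' uv)).
by apply: cgr_ext (cgr_addr v uv') => c; rewrite addnC.
Qed.

Lemma cgr_sum (I : Type) (r : seq I) (P : pred I) (u v : I -> S -> nat) :
  (forall i, P i -> cgr (u i) (v i)) ->
  cgr (fun c => \sum_(i <- r | P i) u i c) (fun c => \sum_(i <- r | P i) v i c).
Proof.
move=> uv; elim: r => [|i r IH].
  by apply: (@cgr_ext (fun=> 0) _ (fun=> 0)) (cgr_refl _) => c; rewrite big_nil.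
have [Pi|nPi] := boolP (P i).
  by apply: cgr_ext (cgr_add (uv i Pi) IH) => c; rewrite big_cons Pi.
by apply: cgr_ext IH => c; rewrite big_cons (negPf nPi).
Qed.

Lemma cgr_muln n u v : cgr u v ->
  cgr (fun c => n * u c) (fun c => n * v c).
Proof.
move=> uv; elim: n => [|n IH]; first exact: cgr_refl.
by apply: cgr_ext (cgr_add uv IH) => c; rewrite mulSn.
Qed.

End Congruence.

Section Star.
Variables (D : finType) (S : pairing_system D).

(** A letter of the refined system is a letter together with the colours of its
    images under all the involutions. *)
Definition is_star (p : S * {ffun D -> S}) := [forall d, edge d p.1 (p.2 d)].
Definition star : Type := {p | is_star p}.
HB.instance Definition _ := Finite.on star.

Definition centre (p : star) : S := (val p).1.
Definition nbr (d : D) (p : star) : S := (val p).2 d.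

(** Two stars may be exchanged by the [d]-th involution exactly when each
    announces the colour of the other. *)
Definition star_edge d : rel star :=
  fun p q => (nbr d p == centre q) && (nbr d q == centre p).

Lemma nbrP d (p : star) : edge d (centre p) (nbr d p).
Proof. by have /forallP := valP p; apply. Qed.

Lemma star_exists (Q : D -> pred S) (a : S) :
  (forall d, exists2 b, edge d a b & Q d b) ->
  exists2 p : star, centre p = a & forall d, Q d (nbr d p).
Proof.
move=> QP.
have {}QP d : exists b, edge d a b && Q d b.
  by have [b ab Qb] := QP d; exists b; rewrite ab.
have st : is_star (a, [ffun d => xchoose (QP d)]).
  by apply/forallP => d; rewrite ffunE; case/andP: (xchooseP (QP d)).
exists (exist (fun p => is_true (is_star p)) _ st) => // d; rewrite /nbr /= ffunE.
by case/andP: (xchooseP (QP d)).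
Qed.

Lemma star_exists1 d a b : edge d a b -> exists2 p, centre p = a & nbr d p = b.
Proof.
move=> ab; have [] := @star_exists (fun d' b' => (d' == d) ==> (b' == b)) a.
  move=> d'; have [->|dd'] := eqVneq d' d; first by exists b; rewrite ?eqxx.
  by have [b' ab'] := edge_total d' a; exists b'.
by move=> p <- /(_ d); rewrite eqxx /= => /eqP <-; exists p.
Qed.

Lemma star_edge_sym d : symmetric (star_edge d).
Proof. by move=> p q; rewrite /star_edge andbC. Qed.

Lemma star_edge_block d p p' q q' :
  star_edge d p q -> star_edge d p' q -> star_edge d p' q' -> star_edge d p q'.
Proof.
rewrite /star_edge => /andP[/eqP pq /eqP qp] /andP[/eqP p'q /eqP qp'].
move=> /andP[/eqP p'q' /eqP q'p'].
by rewrite pq -p'q p'q' -qp qp' q'p' !eqxx.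
Qed.

Lemma star_edge_total d p : exists q, star_edge d p q.
Proof.
have [|q cq nq] := @star_exists1 d (nbr d p) (centre p).
  by rewrite edge_sym nbrP.
by exists q; rewrite /star_edge cq nq !eqxx.
Qed.

Definition star_system : pairing_system D :=
  PairingSystem star_edge_sym star_edge_block star_edge_total.

(** In the star system the set of points whose colour satisfies [Q] is congruent
    to its image under the [d]-th involution: cut both by the pair formed by the
    colour of a point and the colour of its image; each piece is then a block of
    stars, and the image of the piece is the partner block. *)
Lemma cgr_centre_nbr d (Q : pred S) :
  cgr (S := star_system) (fun p => Q (centre p)) (fun p => Q (nbr d p)).
Proof.
have sum1 (P : pred (S * S)) (e : S * S) :
    \sum_(ab | P ab) (ab == e) = P e.
  rewrite big_mkcond (bigD1 e) //= eqxx big1 ?addn0 => [|ab /negPf ->].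
    by case: (P e).
  by case: ifP.
pose P (ab : S * S) := edge d ab.1 ab.2 && Q ab.1.
apply: (@cgr_ext _ star_system
    (fun p => \sum_(ab | P ab) (ab == (centre p, nbr d p))) _
    (fun p => \sum_(ab | P ab) (ab == (nbr d p, centre p)))).
- by move=> p; rewrite sum1 /P /= nbrP.
- by move=> p; rewrite sum1 /P /= edge_sym nbrP.
apply: cgr_sum => -[a b] /andP[/= ab _].
have [p cp np] := star_exists1 ab.
have [|q cq nq] := @star_exists1 d b a; first by rewrite edge_sym.
apply: cgr_ext (@cgr_step _ star_system _ (fun=> 0) d q p _ (cgr_refl _)).
- by move=> r; rewrite add0n /= /star_edge cq nq xpair_eqE [b == _]eq_sym.
- by move=> r; rewrite add0n /= /star_edge cp np xpair_eqE andbC [a == _]eq_sym.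
- by rewrite /= /star_edge nq cp np cq !eqxx.
Qed.

Section Descent.
Variable d0 : D.
Implicit Types (x : D -> S -> S -> nat) (h : D -> S -> nat).

(** The next definitions express a multiset of stars as a sum of slices, the
    slice [(d, a, b)] being the set of stars at [a] with [d]-neighbour [b], taken
    [x d a b] times. The slices [(d, a, b)] and [(d, b, a)] are partner blocks,
    so only the sum of their coefficients is invariant; [edge_balanced] asks
    that this sum splits as [h d a + h d b]. The multiset of stars then stands
    for [h d a] copies of the letter [a], summed over [d] and [a]. *)
Definition edge_balanced x h :=
  forall d a b, edge d a b -> x d a b + x d b a = h d a + h d b.

Definition weight h : S -> nat := fun a => \sum_d h d a.

Definition spread x : star -> nat := fun p => \sum_d x d (centre p) (nbr d p).

(** If a sum of nonnegative coefficients, one chosen freely in each direction, is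
    always positive, then in some direction all coefficients are positive:
    otherwise a zero could be chosen in each direction. *)
Lemma pos_slice x a : (forall p, centre p = a -> 0 < spread x p) ->
  exists d, forall b, edge d a b -> 0 < x d a b.
Proof.
move=> pos; apply: contrapT => /forallNP no.
have [|p cp xp] := @star_exists (fun d b => x d a b == 0) a.
  move=> d; have /existsNP [b /not_implyP [ab /negP]] := no d.
  by rewrite -eqn0Ngt; exists b.
have := pos _ cp; rewrite /spread big1 // => d _; rewrite cp; exact/eqP.
Qed.

Lemma pos_slice1 x d a b : edge d a b ->
  (forall p, centre p = a -> nbr d p = b -> 0 < spread x p) ->
  0 < x d a b \/ exists d', forall b', edge d' a b' -> 0 < x d' a b'.
Proof.
move=> ab pos; case: (posnP (x d a b)) => [x0|]; [right|by left].
apply: contrapT => /forallNP no.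
have [|p cp xp] := @star_exists
    (fun d' b' => (x d' a b' == 0) && ((d' == d) ==> (b' == b))) a.
  move=> d'; have [->|dd'] := eqVneq d' d.
    by exists b; rewrite ?x0 /=.
  have /existsNP [b' /not_implyP [ab' /negP]] := no d'.
  by rewrite -eqn0Ngt => x0'; exists b'; rewrite // x0'.
have := pos _ cp; rewrite /spread big1 => [|d' _]; last first.
  by rewrite cp; case/andP: (xp d') => /eqP.
by have := xp d; rewrite eqxx /= => /andP[_ /eqP ->] /(_ erefl).
Qed.

(** Removing from [x] one copy of everything above [a] in direction [d] removes
    one letter [a] from the weight. If [h d a] is already zero, all [h d c] with
    [c] in the partner block are positive by balance, and one copy of the partner
    block is first traded in [h] for one copy of the block of [a]. *)
Lemma edge_balanced_sub x h d a : edge_balanced x h ->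
  (forall b, edge d a b -> 0 < x d a b) ->
  exists h', edge_balanced
      (fun d' a' b' => x d' a' b' - ((d' == d) && (a' == a))) h' /\
    cgr (weight h) (fun c => weight h' c + (a == c)).
Proof.
move=> xh pos.
have key h1 : edge_balanced x h1 -> 0 < h1 d a -> cgr (weight h) (weight h1) ->
    exists h', edge_balanced
      (fun d' a' b' => x d' a' b' - ((d' == d) && (a' == a))) h' /\
    cgr (weight h) (fun c => weight h' c + (a == c)).
  move=> xh1 h1pos hh1.
  exists (fun d' a' => h1 d' a' - ((d' == d) && (a' == a))); split.
    move=> d' a' b' ab'; have := xh1 _ _ _ ab'.
    have [dd|//] := eqVneq d' d; last by rewrite /= !subn0.
    subst d'; rewrite /=.
    have pa : a' = a -> 0 < x d a' b' by move=> e; subst a'; exact: pos.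
    have pb : b' = a -> 0 < x d b' a'.
      by move=> e; subst b'; apply: pos; rewrite edge_sym.
    case: eqVneq => [ea|_]; case: eqVneq => [eb|_] /=;
      try (have := pa ea); try (have := pb eb); subst; rewrite ?subn0; try lia.
  apply: (cgr_trans hh1); rewrite [X in cgr _ X](_ : _ = weight h1).
    exact: cgr_refl.
  apply/funext => c; rewrite /weight (bigD1 d) //= [RHS](bigD1 d) //= eqxx /=.
  rewrite (eq_bigr (fun i => h1 i c)) => [|i /negPf ->]; last by rewrite subn0.
  by case: (eqVneq c a) => [->|]; lia.
case: (posnP (h d a)) => [h0|hp]; last exact: (key h xh hp (cgr_refl _)).
(* Trade the block of [b], which contains [a], against the block of [a]. *)
have [b ab] := edge_total d a.
have hpos c : edge d a c -> 0 < h d c.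
  by move=> ac; have := xh _ _ _ ac; have := pos _ ac; lia.
apply: (key (fun d' c => (h d' c - ((d' == d) && edge d a c))
                          + ((d' == d) && edge d b c))).
- move=> d' a' b' ab'; have := xh _ _ _ ab'.
  have [dd|//] := eqVneq d' d; last by rewrite /= !subn0 !addn0.
  subst d'; rewrite /= => ->.
  have e1 p q : edge d p q -> edge d a p -> edge d b q.
    move=> pq ap; apply: (@edge_block _ _ d b p a q) => //.
      by rewrite edge_sym.
    by rewrite edge_sym.
  have e2 p q : edge d p q -> edge d b q -> edge d a p.
    move=> pq bq; apply: (@edge_block _ _ d a q b p) => //.
      by rewrite edge_sym.
    by rewrite edge_sym.
  have ba' : edge d b' a' by rewrite edge_sym.
  have -> : edge d b b' = edge d a a'.
    by apply/idP/idP; [apply: e2|apply: e1].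
  have -> : edge d b a' = edge d a b'.
    by apply/idP/idP; [apply: e2|apply: e1].
  have := hpos a'; have := hpos b'.
  by case: (edge d a a'); case: (edge d a b') => /= H1 H2;
    try have {}H1 := H1 isT; try have {}H2 := H2 isT; lia.
- by rewrite eqxx /= [edge d b a]edge_sym ab addn1.
- have tpos c : edge d a c -> 0 < weight h c.
    by move=> /hpos; rewrite /weight (bigD1 d) //=; lia.
  have -> : weight h = fun c => (weight h c - edge d a c) + edge d a c.
    by apply/funext => c; case: (boolP (edge d a c)) => [/tpos|] /=; lia.
  apply: cgr_ext (cgr_step ab (cgr_refl _)) => // c.
  rewrite /weight (bigD1 d) //= [RHS](bigD1 d) //= eqxx /=.
  rewrite [in RHS](eq_bigr (fun i => h i c)) => [|i /negPf ->]; last first.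
    by rewrite subn0 addn0.
  by case: (boolP (edge d a c)) => [/hpos|] /=; lia.
Qed.

Lemma spread_sub x d a p : (forall b, edge d a b -> 0 < x d a b) ->
  spread x p =
  spread (fun d' a' b' => x d' a' b' - ((d' == d) && (a' == a))) p
    + (centre p == a).
Proof.
move=> pos; rewrite /spread (bigD1 d) //= [in RHS](bigD1 d) //=.
rewrite [in RHS](eq_bigr (fun i => x i (centre p) (nbr i p)));
  last by move=> i /negPf -> /=; rewrite subn0.
rewrite eqxx /=; case: eqVneq => [ca|_] /=; last by lia.
by have := pos (nbr d p); rewrite -ca => /(_ (nbrP _ _)); lia.
Qed.

(** The image of a multiset of letters under [a |-> sum of the stars at a]. *)
Definition star_lift (u : S -> nat) : star -> nat := fun p => u (centre p).

(** The invariant behind the embedding: [n] is a sum of slices standing for a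
    multiset of letters congruent to [v]. *)
Definition descends v n := exists x h,
  [/\ n =1 spread x, edge_balanced x h & cgr (weight h) v].

Lemma star_lift_descends v : descends v (star_lift v).
Proof.
(* All the stars are counted in the single direction [d0]. *)
exists (fun d a _ => (d == d0) * v a), (fun d a => (d == d0) * v a).
have sum1 a : \sum_d (d == d0) * v a = v a.
  by rewrite (bigD1 d0) //= eqxx mul1n big1 ?addn0 // => d /negPf ->.
split=> //; first by move=> p; rewrite /spread sum1.
by apply: cgr_ext (cgr_refl _) => // a; rewrite /weight sum1.
Qed.

Lemma descends_sub v n a : descends v (fun p => n p + (centre p == a)) ->
  exists2 v', descends v' n & cgr v (fun c => v' c + (a == c)).
Proof.
move=> [x [h [nx xh hv]]].
have [|d pos] := @pos_slice x a; first by move=> p cp; rewrite -nx cp eqxx addn1.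
have [h' [xh' hh']] := edge_balanced_sub xh pos.
exists (weight h'); last exact: cgr_trans (cgr_sym hv) hh'.
exists (fun d' a' b' => x d' a' b' - ((d' == d) && (a' == a))), h'.
split=> //; last exact: cgr_refl.
by move=> p; have := nx p; rewrite (spread_sub p pos); lia.
Qed.

(** If [n] contains the whole slice [(d, a, b)], this slice can be made to appear
    in the decomposition. When it does not, some direction [d'] carries a full
    copy of the stars at [a], which can be moved from [d'] to [d]. *)
Lemma descends_slice v n d a b : edge d a b -> descends v n ->
  (forall p, centre p = a -> nbr d p = b -> 0 < n p) ->
  exists x h, [/\ n =1 spread x, edge_balanced x h, cgr (weight h) v &
               0 < x d a b].
Proof.
move=> ab [x [h [nx xh hv]]] pos.
have [|xab|[d' pos']] := @pos_slice1 x d a b ab; last 2 first.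
- by exists x, h.
- have [h' [xh' hh']] := edge_balanced_sub xh pos'.
  exists (fun e a' b' => x e a' b' - ((e == d') && (a' == a))
                         + ((e == d) && (a' == a))).
  exists (fun e a' => h' e a' + ((e == d) && (a' == a))).
  split; last by rewrite !eqxx addn1.
  + move=> p; rewrite nx (spread_sub p pos') /spread big_split /=.
    congr (_ + _); rewrite (bigD1 d) //= eqxx /= big1 ?addn0 // => e /negPf ->.
    by [].
  + by move=> e a' b' ab'; have := xh' _ _ _ ab'; lia.
  + apply: cgr_trans hv; apply: cgr_sym; apply: cgr_ext hh' => // c.
    rewrite /weight big_split /=; congr (_ + _).
    rewrite (bigD1 d) //= eqxx /= big1 ?addn0 1?eq_sym // => e /negPf ->.
    by [].
- by move=> p cp np; rewrite -nx; exact: pos.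
Qed.

(** A generating step of the congruence of stars replaces a slice [(d, b, a)] by
    the slice [(d, a, b)], which does not change the sum of the two
    coefficients. *)
Lemma descends_move v z d p q : star_edge d p q ->
  descends v (fun r => z r + star_edge d p r) ->
  descends v (fun r => z r + star_edge d q r).
Proof.
move=> /andP[/eqP pq /eqP qp].
set a := centre p in qp *; set b := centre q in pq *.
have ab : edge d a b by rewrite -pq nbrP.
have Ep r : star_edge d p r = (centre r == b) && (nbr d r == a).
  by rewrite /star_edge pq eq_sym.
have Eq r : star_edge d q r = (centre r == a) && (nbr d r == b).
  by rewrite /star_edge qp eq_sym.
move=> /(@descends_slice _ _ d b a) [||x [h [nx xh hv xba]]].
- by rewrite edge_sym.
- by move=> r cr nr; rewrite Ep cr nr !eqxx addn1.
exists (fun e a' b' => x e a' b' - [&& e == d, a' == b & b' == a]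
          + [&& e == d, a' == a & b' == b]), h.
split=> //.
- move=> r; have := nx r; rewrite /spread Ep Eq (bigD1 d) //= => E.
  rewrite (bigD1 d) //= eqxx /=; move: E.
  rewrite [in X in _ -> X](eq_bigr (fun i => x i (centre r) (nbr i r)));
    last by move=> i /negPf -> /=; rewrite subn0 addn0.
  set t := \sum_(_ | _) _.
  case: (eqVneq (centre r) b) => [->|]; case: (eqVneq (nbr d r) a) => [->|] //=;
    by lia.
- move=> e a' b' ab'; have := xh _ _ _ ab'.
  have [->|_] := eqVneq e d; last by rewrite /= !subn0 !addn0.
  have P1 : (a' == b) && (b' == a) -> 0 < x d a' b' by case/andP=> /eqP -> /eqP ->.
  have P2 : (a' == a) && (b' == b) -> 0 < x d b' a' by case/andP=> /eqP -> /eqP ->.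
  rewrite /= [(b' == b) && _]andbC [(b' == a) && _]andbC.
  move: P1 P2; case: (_ && _); case: (_ && _) => /= P1 P2;
    try have {}P1 := P1 isT; try have {}P2 := P2 isT; lia.
Qed.

Lemma cgr_descends v n n' : cgr (S := star_system) n n' -> descends v n ->
  descends v n'.
Proof. by move=> + bn; elim=> // z d p q pq _; exact: descends_move. Qed.

Lemma descends0 v : descends v (fun=> 0) -> cgr v (fun=> 0).
Proof.
move=> [x [h [nx xh hv]]]; apply: (cgr_trans (cgr_sym hv)).
have x0 d a b : edge d a b -> x d a b = 0.
  move=> ab; have [p <- <-] := star_exists1 ab.
  by have := nx p; rewrite /spread (bigD1 d) //=; lia.
apply: cgr_ext (cgr_refl _) => // a; rewrite /weight big1 // => d _.
have [b ab] := edge_total d a; have := xh _ _ _ ab.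
by rewrite (x0 _ _ _ ab) (x0 d b a) 1?edge_sym //; lia.
Qed.

Lemma descends_star_lift_sub v u w : descends v (fun p => star_lift u p + w p) ->
  exists2 v', descends v' w & cgr v (fun c => v' c + u c).
Proof.
move: {2}(\sum_a u a) (leqnn (\sum_a u a)) => k.
elim: k u v => [|k IH] u v uk bal.
  have u0 a : u a = 0 by move: uk; rewrite (bigD1 a) //=; lia.
  exists v; last by apply: cgr_ext (cgr_refl _) => // c; rewrite u0 addn0.
  by apply: (cgr_descends _ bal); apply: cgr_ext (cgr_refl _) => // p;
    rewrite /star_lift u0.
case: (pselect (exists a, 0 < u a)) => [[a ua]|/forallNP no]; last first.
  apply: IH => //; rewrite big1 // => a _; have := no a; lia.
pose u' c := u c - (a == c).
have uu' c : u c = u' c + (a == c).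
  by rewrite /u'; case: eqVneq => [<-|] /=; lia.
have [|v1 bal1 vv1] := @descends_sub v (fun p => star_lift u' p + w p) a.
  rewrite [X in descends _ X](_ : _ = fun p => star_lift u p + w p) //.
  by apply/funext => p; rewrite /star_lift uu' eq_sym addnAC.
have [|v' bal' v1v'] := IH u' v1 _ bal1.
  move: uk; rewrite (bigD1 a) //= [X in X <= k](bigD1 a) //=.
  rewrite [in X in _ -> X](eq_bigr u) /u' ?eqxx; first by lia.
  by move=> i ia; rewrite eq_sym (negPf ia) subn0.
exists v' => //; apply: (cgr_trans vv1); apply: cgr_ext (cgr_addr _ v1v') => // c.
by rewrite uu' addnA.
Qed.

(** Refinement by stars reflects the algebraic preorder: starting from the
    decomposition of [star_lift v], moves lead to one of [star_lift u + w], and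
    the letters of [u] can be removed from it one at a time. *)
Lemma star_lift_descent u v w :
  cgr (S := star_system) (fun p => star_lift u p + w p) (star_lift v) ->
  exists v', cgr v (fun c => v' c + u c).
Proof.
move=> /cgr_sym/cgr_descends/(_ (star_lift_descends v))/descends_star_lift_sub.
by move=> [v' _ ?]; exists v'.
Qed.

Lemma star_lift_inj u v : cgr (S := star_system) (star_lift u) (star_lift v) -> cgr u v.
Proof.
move=> uv; have [|v' bal' vv'] := @descends_star_lift_sub v u (fun=> 0).
  apply: cgr_descends (star_lift_descends v); apply: cgr_sym.
  by apply: cgr_ext uv => // p; rewrite addn0.
apply: cgr_sym; apply: (cgr_trans vv').
by apply: cgr_ext (cgr_addr u (descends0 bal')).
Qed.

End Descent.
End Star.

(** * The limit space and its involutions *)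

Section Tower.
Variables (D : finType) (S : pairing_system D).

Fixpoint tower n : pairing_system D :=
  if n is m.+1 then star_system (tower m) else S.

(** The inverse limit of the iterated star systems. The parameter [R] is the
    field in which distances take their values; it is part of the type so that
    the metric structure can be attached to it. *)
Record tower_limit (R : Type) := TowerLimit {
  thread :> forall n, tower n;
  threadP : forall n, centre (thread n.+1) = thread n
}.

HB.instance Definition _ R := gen_eqMixin (tower_limit R).
HB.instance Definition _ R := gen_choiceMixin (tower_limit R).
End Tower.

Section Limit.
Variables (D : finType) (S : pairing_system D) (R : realType).
Local Notation Z := (tower_limit S R).
Implicit Types x y z : Z.

Lemma thread_inj x y : (forall n, x n = y n) -> x = y.
Proof.
case: x y => [x xP] [y yP] /= xy.
have {}xy : x = y by apply: functional_extensionality_dep.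
by subst y; congr TowerLimit; exact: Prop_irrelevance.
Qed.

Lemma thread_down n m x y : (m <= n)%N -> x n = y n -> x m = y m.
Proof.
move=> /subnK <-; elim: (n - m)%N => [//|k IH] /(congr1 (@centre _ _)).
by rewrite !threadP; exact: IH.
Qed.

(** The ultrametric given by the first level at which two threads differ. *)
Definition thread_dist x y : R :=
  if pselect (exists n, x n != y n) is left h then (ex_minn h).+1%:R^-1%R
  else 0%R.

Lemma thread_dist_lt x y n : (thread_dist x y < n.+1%:R^-1)%R <-> x n = y n.
Proof.
rewrite /thread_dist; case: pselect => [h|no]; last first.
  split=> [_|_]; last by rewrite invr_gt0.
  by apply/eqP/negP => /negP xy; apply: no; exists n.
case: ex_minnP => m xym minm.
rewrite ltf_pV2 ?posrE // ltr_nat ltnS; split=> [nm|xyn].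
  by apply: contraTeq nm => /minm; rewrite ltnNge => ->.
rewrite ltnNge; apply/negP => mn; move/eqP: xym; apply.
exact: thread_down xyn.
Qed.

Lemma thread_dist_ge0 x y : (0 <= thread_dist x y)%R.
Proof. by rewrite /thread_dist; case: pselect => // h; rewrite invr_ge0. Qed.

Lemma thread_distxx x : thread_dist x x = 0%R.
Proof.
by rewrite /thread_dist; case: pselect => // h; case: ex_minnP => n; rewrite eqxx.
Qed.

Lemma thread_dist_eq0 x y : thread_dist x y = 0%R -> x = y.
Proof.
move=> xy; apply: thread_inj => n; apply/thread_dist_lt.
by rewrite xy invr_gt0.
Qed.

Lemma thread_dist_sym x y : thread_dist x y = thread_dist y x.
Proof.
rewrite /thread_dist; case: pselect => [h|no]; case: pselect => [h'|no'] //.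
- case: ex_minnP => m xym minm; case: ex_minnP => m' xym' minm'.
  suff -> : m = m' by [].
  by apply/eqP; rewrite eqn_leq minm ?minm' // eq_sym.
- by case: no'; case: h => n xy; exists n; rewrite eq_sym.
- by case: no; case: h' => n xy; exists n; rewrite eq_sym.
Qed.

Lemma thread_dist_triangle y x z :
  (thread_dist x z <= thread_dist x y + thread_dist y z)%R.
Proof.
rewrite {1}/thread_dist; case: pselect => [h|_]; last first.
  by rewrite addr_ge0 ?thread_dist_ge0.
case: ex_minnP => n xz _.
have [xy|/eqP xy] := eqVneq (x n) (y n).
  have yz : y n <> z n by rewrite -xy; exact/eqP.
  apply: ler_wpDl; first exact: thread_dist_ge0.
  by rewrite leNgt; apply/negP => /thread_dist_lt.
apply: ler_wpDr; first exact: thread_dist_ge0.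
by rewrite leNgt; apply/negP => /thread_dist_lt.
Qed.

HB.instance Definition _ := isMetric.Build R Z
  thread_distxx thread_dist_eq0 thread_dist_sym thread_dist_triangle.

Lemma nbhs_thread x (U : set Z) :
  nbhs x U <-> exists n, forall y, x n = y n -> U y.
Proof.
rewrite -nbhs_ballE; split=> [[e /= e0 xeU]|[n nU]].
  have [N _ /(_ N (leqnn N)) Ne] := near_infty_natSinv_lt (PosNum e0).
  exists N => y xy; apply: xeU; rewrite ballEmdist /=.
  by apply: lt_trans Ne; apply/thread_dist_lt.
exists n.+1%:R^-1%R; first by rewrite /= invr_gt0.
by move=> y; rewrite ballEmdist /= => /thread_dist_lt; exact: nU.
Qed.

Definition at_level n (C : set Z) := forall x y, x n = y n -> C x -> C y.

Lemma at_level_leq n m C : (n <= m)%N -> at_level n C -> at_level m C.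
Proof. by move=> nm Cn x y xy; apply: Cn; exact: thread_down xy. Qed.

Lemma at_level_clopen n C : at_level n C -> clopen C.
Proof.
move=> Cn; split.
  rewrite openE => x Cx; apply/nbhs_thread; exists n => y xy; exact: Cn xy Cx.
rewrite -openC openE => x nCx; apply/nbhs_thread; exists n => y xy Cy.
by apply: nCx; exact: Cn (esym xy) Cy.
Qed.

(** An ultrafilter selects one letter at each level since alphabets are finite,
    and the selected letters form a thread, to which it converges. *)
Lemma limit_compact : compact [set: Z].
Proof.
rewrite compact_ultra => F FU _.
have ex n : exists p : tower S n, F [set x : Z | x n = p].
  apply: contrapT => /forallNP no.
  have nF (p : tower S n) : F [set x : Z | x n <> p].
    by case: (@in_ultra_setVsetC _ F [set x : Z | x n = p]) => // /no.
  have /filter_ex [x /(_ (x n))] :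
      F [set x : Z | forall p : tower S n, x n <> p].
    exact: filter_forall nF.
  by [].
pose t n := projT1 (cid (ex n)).
have tP n : F [set x : Z | x n = t n] by rewrite /t; case: cid.
have tC n : centre (t n.+1) = t n.
  have /filter_ex [x [<- <-]] :
      F ([set x : Z | x n.+1 = t n.+1] `&` [set x : Z | x n = t n]).
    exact: filterI.
  exact: threadP.
exists (TowerLimit R tC); split=> // U /nbhs_thread [n nU].
by apply: filterS (tP n) => x /= xt; apply: nU.
Qed.

(** By compactness, the levels at which membership in a clopen set is decided
    near each point have a common bound. *)
Lemma clopen_at_level C : clopen C -> exists n, at_level n C.
Proof.
move=> [oC cC].
have [N _ NP] : \forall n \near \oo, [set: Z] `<=`
    [set x : Z | forall y : Z, x n = y n -> C x -> C y].
  apply: (proj1 (compact_near_coveringP _) limit_compact) => x _.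
  have [n xn] : exists n, forall y z : Z, (x : Z) n = y n -> y n = z n -> C y -> C z.
    have [Cx|nCx] := pselect (C x).
      have /nbhs_thread [n nC] := open_nbhs_nbhs (conj oC Cx).
      by exists n => y z xy yz _; apply: nC; rewrite xy.
    have oC' : open (~` C) by rewrite openC.
    have /nbhs_thread [n nC] := open_nbhs_nbhs (conj oC' nCx).
    by exists n => y z xy yz Cy; have := nC y xy.
  exists ([set y : Z | (x : Z) n = y n], [set m | (n <= m)%N]).
    split; first by apply/nbhs_thread; exists n.
    by exists n.
  move=> [y m] [/= xy nm] z yz; apply: xn xy _.
  exact: thread_down nm yz.
by exists N => x y; apply: NP => /=.
Qed.

Lemma limit_zero_dimensional : zero_dimensional Z.
Proof.
move=> x y xy.
have [n xyn] : exists n, (x : Z) n <> (y : Z) n.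
  apply: contrapT => no; move/eqP: xy; apply; apply: thread_inj => n.
  by apply: contrapT => xyn; apply: no; exists n.
exists [set z : Z | z n = (x : Z) n]; split=> //; last by move/esym.
by apply: (@at_level_clopen n) => z z' /= <-.
Qed.

Lemma star_over n (q : tower S n) : exists p : tower S n.+1, centre p = q.
Proof.
have [p pq _] := @star_exists D (tower S n) (fun _ _ => true) q
  (fun d => let: ex_intro b ab := edge_total d q in ex_intro2 _ _ b ab isT).
by exists p.
Qed.

Definition over n (q : tower S n) : tower S n.+1 := projT1 (cid (star_over q)).

Lemma overP n (q : tower S n) : centre (over q) = q.
Proof. by rewrite /over; case: cid. Qed.

(** Follow [f] as long as it is coherent and complete arbitrarily afterwards. *)
Lemma thread_extend n (f : forall k, tower S k) :
  (forall k, (k < n)%N -> centre (f k.+1) = f k) -> exists x : Z, x n = f n.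
Proof.
move=> fP; pose h := nat_rect (fun k => tower S k : Type) (f 0)
  (fun k q => if centre (f k.+1) == q then f k.+1 else over q).
have hP k : centre (h k.+1) = h k.
  by rewrite /=; case: ifP => [/eqP|_]; rewrite ?overP.
have hf k : (k <= n)%N -> h k = f k.
  elim: k => [//|k IH] kn /=.
  by rewrite IH ?(ltnW kn) // (fP _ kn) eqxx.
by exists (TowerLimit R hP); apply: hf.
Qed.

Lemma thread_through n (p : tower S n) : exists x : Z, x n = p.
Proof.
suff [f fp fP] : exists2 f : forall k, tower S k, f n = p &
    forall k, (k < n)%N -> centre (f k.+1) = f k.
  by rewrite -fp; exact: thread_extend.
elim: n p => [|n IH] p.
  by exists (nat_rect (fun k => tower S k : Type) p (fun k q => over q)).
have [f fp fP] := IH (centre p).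
exists (@eqtype.dfwith _ (fun k => tower S k : Type) f n.+1 p); first by rewrite dfwith_in.
move=> k; rewrite ltnS leq_eqVlt => /predU1P[->|kn].
  by rewrite dfwith_in dfwith_out //; lia.
by rewrite !dfwith_out; [exact: fP|lia|lia].
Qed.

Lemma thread_edge d x n : edge d (x n) (nbr d (x n.+1)).
Proof. by rewrite -(threadP x n); exact: nbrP. Qed.

(** A star knows the colour of its image in each direction, so the thread of
    [x] up to level [n.+1] determines the image of [x] up to level [n]. *)
Definition flip_thread d x n : tower S n := nbr d (x n.+1).

Lemma flip_threadP d x n : centre (flip_thread d x n.+1) = flip_thread d x n.
Proof. by have /andP[/eqP] := thread_edge d x n.+1. Qed.

Definition flip d x : Z := TowerLimit R (flip_threadP d x).

Lemma flipE d x n : flip d x n = nbr d (x n.+1). Proof. by []. Qed.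

Lemma flipK d : involutive (flip d).
Proof.
move=> x; apply: thread_inj => n; rewrite !flipE.
by have /andP[_ /eqP ->] := thread_edge d x n.+1; rewrite threadP.
Qed.

Lemma at_level_flip d n C : at_level n C -> at_level n.+1 (flip d @^-1` C).
Proof. by move=> Cn x y xy; apply: Cn; rewrite !flipE xy. Qed.

Lemma flip_continuous d : continuous (flip d).
Proof.
move=> x U /nbhs_thread [n nU]; apply/nbhs_thread; exists n.+1 => y xy.
by apply: nU; rewrite !flipE xy.
Qed.

End Limit.

(** * Free groups *)

Section FreeGroup.
Local Open Scope quotient_scope.
Variable I : choiceType.
Local Notation word := (seq (I * bool)).
Implicit Types w : word.

Definition letter_inv (l : I * bool) : I * bool := (l.1, ~~ l.2).
Definition word_inv w : word := rev (map letter_inv w).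

Definition reversible (T : Type) (h : I * bool -> T -> T) :=
  forall l, cancel (h (letter_inv l)) (h l).

(** Words are identified when they act in the same way wherever letters act by
    bijections inverse to each other. Acting on a group by left translations
    gives the universal property, and acting on a space defines the action,
    without reduced words. *)
Definition free_equiv w w' : bool :=
  `[< forall (T : Type) (h : I * bool -> T -> T), reversible h ->
        forall x, foldr h x w = foldr h x w' >].

Lemma free_equivP w w' : reflect (forall (T : Type) (h : I * bool -> T -> T),
  reversible h -> forall x, foldr h x w = foldr h x w') (free_equiv w w').
Proof. exact: asboolP. Qed.

Lemma free_equiv_refl : reflexive free_equiv.
Proof. by move=> w; apply/free_equivP. Qed.

Lemma free_equiv_sym : symmetric free_equiv.
Proof.
by move=> w w'; apply/free_equivP/free_equivP => h T f fr x; rewrite h.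
Qed.

Lemma free_equiv_trans : transitive free_equiv.
Proof.
move=> w2 w1 w3 /free_equivP h1 /free_equivP h2; apply/free_equivP => T f fr x.
by rewrite h1 // h2.
Qed.

Canonical free_equiv_rel :=
  EquivRel free_equiv free_equiv_refl free_equiv_sym free_equiv_trans.

Definition free_group : Type := {eq_quot free_equiv_rel}.
HB.instance Definition _ := Choice.on free_group.
HB.instance Definition _ := EqQuotient.on free_group.

Definition free_class w : free_group := \pi_free_group w.

Lemma free_classP w w' : free_class w = free_class w' <->
  forall (T : Type) (h : I * bool -> T -> T), reversible h ->
    forall x, foldr h x w = foldr h x w'.
Proof.
rewrite /free_class; split=> [/eqmodP/free_equivP //|h].
by apply/eqmodP/free_equivP.
Qed.

Lemma free_classE (g : free_group) : free_class (repr g) = g.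
Proof. by rewrite /free_class reprK. Qed.

Lemma word_invK (T : Type) (h : I * bool -> T -> T) : reversible h ->
  forall w x, foldr h (foldr h x w) (word_inv w) = x.
Proof.
move=> hr w x; rewrite /word_inv; elim: w => [//|l w IH] /=.
rewrite rev_cons foldr_rcons.
have {2}-> : l = letter_inv (letter_inv l).
  by case: l => i b; rewrite /letter_inv /= negbK.
by rewrite hr.
Qed.

Lemma word_invKV (T : Type) (h : I * bool -> T -> T) : reversible h ->
  forall w x, foldr h (foldr h x (word_inv w)) w = x.
Proof.
move=> hr w x.
have {2}-> : w = word_inv (word_inv w); last exact: word_invK.
rewrite /word_inv map_rev revK -map_comp map_id_in // => -[i b] _.
by rewrite /letter_inv /= negbK.
Qed.

Definition free_mul (g h : free_group) := free_class (repr g ++ repr h).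
Definition free_inv (g : free_group) := free_class (word_inv (repr g)).

Lemma free_mulE w w' :
  free_mul (free_class w) (free_class w') = free_class (w ++ w').
Proof.
apply/free_classP => T h hr x; rewrite !foldr_cat.
have /free_classP -> // := free_classE (free_class w).
by have /free_classP -> // := free_classE (free_class w').
Qed.

Let free_mulA : associative free_mul.
Proof.
move=> x y z; rewrite -(free_classE x) -(free_classE y) -(free_classE z).
by rewrite !free_mulE catA.
Qed.

Let free_mul1 : left_id (free_class [::]) free_mul.
Proof. by move=> x; rewrite -(free_classE x) free_mulE. Qed.

Let free_1mul : right_id (free_class [::]) free_mul.
Proof. by move=> x; rewrite -(free_classE x) free_mulE cats0. Qed.

Let free_mulV : left_inverse (free_class [::]) free_inv free_mul.
Proof.
move=> x; rewrite -[X in free_mul _ X]free_classE free_mulE.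
by apply/free_classP => T h hr y; rewrite foldr_cat word_invK.
Qed.

Let free_Vmul : right_inverse (free_class [::]) free_inv free_mul.
Proof.
move=> x; rewrite -[X in free_mul X _]free_classE free_mulE.
by apply/free_classP => T h hr y; rewrite foldr_cat word_invKV.
Qed.

HB.instance Definition _ := isGroup.Build free_group
  free_mulA free_mul1 free_1mul free_mulV free_Vmul.

Definition free_gen (i : I) : free_group := free_class [:: (i, true)].

Lemma free_class_cons l w : free_class (l :: w) =
  ((if l.2 then free_gen l.1 else (free_gen l.1)^-1) * free_class w)%g.
Proof.
have -> : (if l.2 then free_gen l.1 else (free_gen l.1)^-1)%g = free_class [:: l].
  case: l => i [] //=.
  apply: (@mulgI _ (free_gen i)); rewrite mulgV.
  rewrite [RHS]free_mulE; apply/free_classP => T h hr x /=.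
  by rewrite (hr (i, true)).
by rewrite [RHS]free_mulE.
Qed.

Lemma free_gen_basis : free_basis free_gen.
Proof.
move=> H h.
pose val l := if l.2 then h l.1 else (h l.1)^-1%g.
pose ev w := foldr (fun l x => val l * x)%g 1%g w.
have val_rev : reversible (fun l (x : H) => val l * x)%g.
  by move=> [i []] x; rewrite /val /= mulgA ?mulgV ?mulVg mul1g.
have evE w w' : free_class w = free_class w' -> ev w = ev w'.
  by move=> /free_classP; apply.
have ev_cat w w' : ev (w ++ w') = (ev w * ev w')%g.
  by elim: w => [|l w IH] /=; rewrite ?mul1g // IH mulgA.
pose phi (g : free_group) := ev (repr g).
have phiM : {morph phi : x y / (x * y)%g}.
  by move=> x y; rewrite /phi -ev_cat; apply: evE; rewrite free_classE.
split.
  pose phi' : {multiplicative free_group -> H} :=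
    HB.pack phi (isMultiplicative.Build _ _ phi phiM).
  exists phi' => i /=; rewrite /phi (evE _ [:: (i, true)]) ?free_classE //.
  by rewrite /ev /= mulg1.
move=> f g fh gh x; rewrite -(free_classE x).
have mor1 (k : {multiplicative free_group -> H}) : k 1%g = 1%g.
  by apply: (@mulgI _ (k 1%g)); rewrite -gmulfM !mulg1.
have morV (k : {multiplicative free_group -> H}) y : k (y^-1)%g = ((k y)^-1)%g.
  by apply: (@mulgI _ (k y)); rewrite -gmulfM !mulgV.
elim: (repr x) => [|l w IH]; first by rewrite !mor1.
rewrite free_class_cons !gmulfM IH; congr (_ * _)%g.
by case: ifP; rewrite ?morV fh gh.
Qed.

End FreeGroup.

Lemma free_basis_reindex (I J : Type) (F : groupType) (b : I -> F)
    (f : J -> I) (g : I -> J) : cancel f g -> cancel g f ->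
  free_basis b -> free_basis (b \o f).
Proof.
move=> fK gK bP H h; have [[phi phiP] uniq] := bP H (h \o g); split.
  by exists phi => j /=; rewrite phiP /= fK.
move=> p q pP qP; apply: uniq => i.
  by rewrite /= -(pP (g i)) /= gK.
by rewrite /= -(qP (g i)) /= gK.
Qed.

Lemma free_group_fg (I : finType) : fg_free_group (free_group I).
Proof.
exists #|I|, (@free_gen I \o enum_val).
apply: (@free_basis_reindex _ _ _ _ enum_val enum_rank).
- exact: enum_valK.
- exact: enum_rankK.
- exact: free_gen_basis.
Qed.

Section FreeAction.
Variables (I : choiceType) (Z : topologicalType) (f : I -> Z -> Z).
Hypothesis fK : forall i, involutive (f i).
Hypothesis fC : forall i, continuous (f i).

Let h (l : I * bool) : Z -> Z := f l.1.

Let h_rev : reversible h.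
Proof. by move=> l x; rewrite /h fK. Qed.

Definition free_act (g : free_group I) (z : Z) : Z := foldr h z (repr g).

Lemma free_act_class w z : free_act (free_class w) z = foldr h z w.
Proof.
by rewrite /free_act; have /free_classP -> := free_classE (free_class w).
Qed.

Let free_act1 z : free_act 1%g z = z.
Proof. exact: free_act_class. Qed.

Let free_actM a b z : free_act (a * b)%g z = free_act a (free_act b z).
Proof.
by rewrite -(free_classE a) -(free_classE b) [(_ * _)%g]free_mulE
  !free_act_class foldr_cat.
Qed.

Let free_act_continuous g : continuous (free_act g).
Proof.
rewrite /free_act; elim: (repr g) => [|l w IH] z; first exact: cvg_id.
by apply: continuous_comp; [exact: IH|exact: fC].
Qed.

Definition free_action : homeo_action (free_group I) Z :=
  HomeoAction free_act1 free_actM free_act_continuous.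

Lemma free_action_gen i : free_action (free_gen i) =1 f i.
Proof. by move=> z; rewrite /= free_act_class. Qed.

End FreeAction.

(** * The type semigroup of the limit space *)

Section Glue.
Variables (G : groupType) (Z : topologicalType) (theta : homeo_action G Z).

Lemma type_class_cat s s' :
  type_class theta (s ++ s') = (type_class theta s + type_class theta s')%R.
Proof. exact/esym/type_addE. Qed.

Lemma type_class_map (A : Type) (C : A -> clopen_algebra Z) (r : seq A) :
  type_class theta [seq C a | a <- r] =
  (\sum_(a <- r) type_class theta [:: C a])%R.
Proof.
elim: r => [|a r IH]; first by rewrite big_nil.
by rewrite big_cons -IH -type_class_cat.
Qed.

(** A finite disjoint union, translated by [g], has the sum of the classes of its
    parts. The translation is included so that a block and its partner can be
    compared with one and the same set. *)
Lemma type_class_glue (A : finType) (P : pred A) (C : A -> clopen_algebra Z)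
    (U : clopen_algebra Z) g :
  (forall a b z, (C a : set Z) z -> (C b : set Z) z -> a = b) ->
  (forall z, (U : set Z) (theta g z) <-> exists2 a, P a & (C a : set Z) z) ->
  (\sum_(a | P a) type_class theta [:: C a])%R = type_class theta [:: U].
Proof.
move=> disj UP; rewrite -big_enum -type_class_map /=; apply/type_classP.
have sz : size [seq C a | a <- enum P] = #|P| by rewrite size_map -cardE.
exists #|P|, (C \o enum_val), (fun=> g), (fun k => k), (fun=> 0%N); split.
- by move=> k k' _ _ [[z i] [[/= Ck ->] [Ck' e]]]; exact: ord_inj.
- have tn (k : 'I_#|P|) (k' : 'I_(size [seq C a | a <- enum P])) :
      k = k' :> nat -> tnth (in_tuple [seq C a | a <- enum P]) k' = C (enum_val k).
    move=> kk; rewrite (tnth_nth U) /= (nth_map (enum_val k)) -?kk -?cardE //.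
    by rewrite -enum_val_nth.
  apply/seteqP; split => -[z i].
    move=> [k _ [/= Ck ->]].
    have kP : (k < #|P|)%N by rewrite -sz.
    by exists (Ordinal kP) => //=; split => //=; rewrite -(tn _ k).
  move=> [k _ [/= Ck ->]].
  have ks : (k < size [seq C a | a <- enum P])%N by rewrite sz.
  by exists (Ordinal ks) => //=; split => //=; rewrite (tn k).
- move=> k k' _ _ [[z i] [[/= [y Cy <-] _] [[y' Cy' e] _]]].
  apply: enum_val_inj; apply: disj Cy _.
  by rewrite -(actK theta g y) -e actK.
- apply/seteqP; split => -[z i].
    move=> [k _]; case: k => -[|//] k1 [/= Uz ->].
    rewrite (tnth_nth U) /= in Uz.
    have [] := (UP (theta g^-1%g z)).1; first by rewrite actVK.
    move=> a Pa Ca; exists (enum_rank_in Pa a) => //=; split => //.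
    by exists (theta g^-1%g z); rewrite ?actVK ?enum_rankK_in.
  move=> [k _ [/= [y Cy <-] ->]].
  exists ord0 => //=; split => //=; rewrite (tnth_nth U) /=.
  by apply/UP; exists (enum_val k) => //; exact: (enum_valP k).
Qed.

End Glue.

Lemma sum_indicator (I : finType) (P : I -> Prop) :
  (forall i j, P i -> P j -> i = j) ->
  (\sum_i `[< P i >])%N = `[< exists i, P i >].
Proof.
move=> uniq; have [[i Pi]|no] := pselect (exists i, P i).
  have -> : `[< exists i, P i >] by apply/asboolP; exists i.
  rewrite (bigD1 i) //= asboolT // big1 ?addn0 // => j ji.
  by rewrite asboolF // => Pj; move/eqP: ji; apply; exact: uniq.
rewrite [in RHS]asboolF // big1 // => i _.
by rewrite asboolF // => Pi; apply: no; exists i.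
Qed.

(** The level set of [s], seen as the function counting its levels above each
    point. *)
Definition height (Z : topologicalType) (s : seq (clopen_algebra Z)) (z : Z) :=
  (\sum_(C <- s) `[< (C : set Z) z >])%N.

(** Count pairs of a level and a piece: above [z] each level of the set lies in
    exactly one piece, and each piece through [z] lies on one level. *)
Lemma height_pieces (Z : topologicalType) (s : seq (clopen_algebra Z))
    (l : nat) (C : 'I_l -> set Z) (n : 'I_l -> nat) z :
  trivIset [set: 'I_l] (fun k => C k `*` [set n k]) ->
  level_set s = \bigcup_(k in [set: 'I_l]) (C k `*` [set n k]) ->
  height s z = (\sum_k `[< C k z >])%N.
Proof.
move=> dC sC.
have sE i : (exists k, C k z /\ n k = i) <->
    exists k : 'I_(size s), (tnth (in_tuple s) k : set Z) z /\ i = k.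
  split=> [[k [Ck nk]]|[k [Ck ->]]].
    have : level_set s (z, i) by rewrite sC; exists k.
    by move=> [j _ [/= ? ->]]; exists j.
  have : level_set s (z, nat_of_ord k) by exists k.
  by rewrite sC => -[j _ [/= ? ?]]; exists j.
rewrite /height (big_nth (ClopenAlgebra clopen0)) big_mkord.
transitivity (\sum_(i < size s) \sum_(k < l) `[< C k z /\ n k = i >])%N.
  apply: eq_bigr => i _; rewrite sum_indicator; last first.
    move=> k k' [Ck nk] [Ck' nk']; apply: dC => //; exists (z, nat_of_ord i).
    by split.
  congr nat_of_bool; apply/asbool_equiv_eq; rewrite sE; split=> [Cz|[k [Cz ik]]].
    by exists i; rewrite (tnth_nth (ClopenAlgebra clopen0)).
  by rewrite (tnth_nth (ClopenAlgebra clopen0)) -ik in Cz.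
rewrite exchange_big /=; apply: eq_bigr => k _; rewrite sum_indicator; last first.
  by move=> i j [_ ei] [_ ej]; apply: ord_inj; rewrite -ei.
congr nat_of_bool; apply/asbool_equiv_eq; split=> [[i []]//|Ck].
have [|i [_ ki]] := (sE (n k)).1; first by exists k.
by exists i.
Qed.

Section TowerSemigroup.
Variables (D : finType) (S : pairing_system D) (R : realType).
Local Notation Z := (tower_limit S R).
Local Notation theta :=
  (free_action (@flipK D S R) (@flip_continuous D S R)).

Definition sample n (p : tower S n) : Z := projT1 (cid (thread_through R p)).

Lemma sampleE n (p : tower S n) : sample p n = p.
Proof. by rewrite /sample; case: cid. Qed.

(** The multiset of the letters at level [n] that lie in [C]. It is used for sets
    decided at level [n], for which the choice of [sample] is immaterial. *)
Definition trace n (C : set Z) : tower S n -> nat := fun p => `[< C (sample p) >].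

(** A set decided at level [n] and its image under an involution are congruent at
    level [n.+1], where stars see the colours of images. *)
Lemma trace_flip m n d (C : set Z) : at_level m C -> (m < n)%N ->
  cgr (@trace n C) (@trace n (flip d @^-1` C)).
Proof.
case: n => [//|n] Cm mn; have Cn : at_level n C by exact: at_level_leq Cm.
pose Q (a : tower S n) := `[< C (sample a) >].
have QE (x : Z) : Q (x n) = `[< C x >].
  by apply: asbool_equiv_eq; split; apply: Cn; rewrite sampleE.
apply: cgr_ext (@cgr_centre_nbr D (tower S n) d Q) => p.
  by rewrite /trace -QE -(threadP (@sample n.+1 p)) sampleE.
by rewrite /trace /= -QE flipE (@sampleE n.+1).
Qed.

Lemma trace_word w n (C : set Z) : at_level n C -> exists N, forall m, (N <= m)%N ->
  cgr (@trace m C)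
      (@trace m ((foldr (fun l : D * bool => @flip D S R l.1))^~ w @^-1` C)).
Proof.
elim: w n C => [|l w IH] n C Cn.
  by exists 0%N => m _; exact: cgr_refl.
have [N NP] := IH _ _ (at_level_flip (d := l.1) Cn).
exists (maxn N n.+1) => m; rewrite geq_max => /andP[Nm nm].
exact: cgr_trans (trace_flip l.1 Cn nm) (NP _ Nm).
Qed.

Lemma trace_act t (C : set Z) : clopen C -> exists N, forall m, (N <= m)%N ->
  cgr (@trace m C) (@trace m (theta t @` C)).
Proof.
move=> /clopen_at_level [n Cn]; have [N NP] := trace_word (repr t^-1%g) Cn.
by exists N => m /NP; rewrite act_image.
Qed.

(** Equidecomposability is a finite amount of data, so some level decides all the
    pieces and all their translates along the words involved. *)
Lemma equidecomposable_height (s s' : seq (clopen_algebra Z)) :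
  equidecomposable theta (level_set s) (level_set s') ->
  exists n, cgr (fun p : tower S n => height s (sample p))
                (fun p : tower S n => height s' (sample p)).
Proof.
move=> [l [C [t [n [m [dA sA dB sB]]]]]].
have ex k : exists N, forall m, (N <= m)%N ->
  cgr (@trace m (C k)) (@trace m (theta (t k) @` C k)).
  by apply: trace_act; exact: clopen_setP.
pose N k := projT1 (cid (ex k)).
have NP k m' : (N k <= m')%N ->
    cgr (@trace m' (C k)) (@trace m' (theta (t k) @` C k)).
  by rewrite /N; case: cid => x; apply.
exists (\max_k N k)%N; set M := (\max_k N k)%N.
apply: cgr_ext (@cgr_sum _ (tower S M) 'I_l (index_enum _) xpredT
    (fun k => @trace M (C k)) (fun k => @trace M (theta (t k) @` C k)) _).
- by move=> p; rewrite (height_pieces _ dA sA).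
- by move=> p; rewrite (height_pieces _ dB sB).
- by move=> k _; apply: NP; exact: leq_bigmax.
Qed.

(** The iterated lift of a multiset of base letters to level [n]: a star at level
    [n] counts as much as its iterated centre, which is the base colour of every
    thread through it. *)
Definition base_lift n (u : S -> nat) : tower S n -> nat :=
  fun p => u (sample p 0).

Lemma base_lift0 u : @base_lift 0 u =1 u.
Proof. by move=> p; rewrite /base_lift sampleE. Qed.

Lemma base_liftS n u : @base_lift n.+1 u =1 star_lift (@base_lift n u).
Proof.
move=> p; rewrite /base_lift /star_lift; congr u.
apply: (@thread_down _ _ _ n 0 (@sample n.+1 p) (@sample n (centre p))) => //.
by rewrite sampleE -(threadP (@sample n.+1 p)) sampleE.
Qed.

Variable d0 : D.

Lemma base_descent n u v (w : tower S n -> nat) :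
  cgr (fun p => base_lift u p + w p)%N (@base_lift n v) ->
  exists v', cgr v (fun c => v' c + u c)%N.
Proof.
elim: n w => [|n IH] w uwv.
  exists w; apply: cgr_sym; apply: cgr_ext uwv => [p|]; last exact: base_lift0.
  by rewrite base_lift0 addnC.
have [|v1 v1P] := @star_lift_descent _ (tower S n) d0
    (@base_lift n u) (@base_lift n v) w.
  by apply: cgr_ext uwv => p; rewrite base_liftS.
apply: (IH v1); apply: cgr_sym; apply: cgr_ext v1P => // c.
by rewrite addnC.
Qed.

Lemma base_inj n u v : cgr (@base_lift n u) (@base_lift n v) -> cgr u v.
Proof.
elim: n => [|n IH] uv.
  by apply: cgr_ext uv; exact: base_lift0.
apply: IH; apply: (@star_lift_inj _ (tower S n) d0).
by apply: cgr_ext uv; exact: base_liftS.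
Qed.

Lemma base_clopen a : clopen [set z : Z | z 0%N = a].
Proof. by apply: (@at_level_clopen _ _ _ 0) => x y /= <-. Qed.

Definition base_class a : type_semigroup theta :=
  type_class theta [:: ClopenAlgebra (base_clopen a)].

Definition base_map (u : S -> nat) : type_semigroup theta :=
  (\sum_a base_class a *+ u a)%R.

Lemma base_mapD u v :
  base_map (fun c => u c + v c)%N = (base_map u + base_map v)%R.
Proof. by rewrite -big_split; apply: eq_bigr => a _; rewrite mulrnDr. Qed.

(** The [d]-th involution exchanges the sets of points coloured in a block and in
    its partner. *)
Lemma base_map_cgr u v : cgr u v -> base_map u = base_map v.
Proof.
have key w d a : base_map (fun c => w c + edge d a c)%N =
    (base_map w + \sum_(c | edge d a c) base_class c)%R.
  rewrite base_mapD; congr (_ + _)%R; rewrite [RHS]big_mkcond.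
  by apply: eq_bigr => c _; case: (edge d a c).
elim=> [//|{}v d a b ab _ ->]; rewrite !key; congr (_ + _)%R.
(* Both sums are the class of the partner block [U] of [b]. *)
have cU : clopen [set z : Z | edge d b (z 0%N)].
  by apply: (@at_level_clopen _ _ _ 0) => x y /= <-.
have disj x y (z : Z) : (ClopenAlgebra (base_clopen x) : set Z) z ->
   (ClopenAlgebra (base_clopen y) : set Z) z -> x = y by move=> /= <-.
rewrite (type_class_glue (U := ClopenAlgebra cU) (g := free_gen d) disj).
  rewrite (type_class_glue (U := ClopenAlgebra cU) (g := 1%g) disj) //.
  move=> z; rewrite act1; split=> [bz|[c bc /= ->]//].
  by exists (z 0%N).
move=> z; rewrite free_action_gen.
have zd : edge d (z 0%N) (flip d z 0%N) := thread_edge d z 0.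
split=> [bz|[c ac /= zc]].
  exists (z 0%N) => //; apply: (edge_block ab (a' := flip d z 0%N)).
    by rewrite edge_sym.
  by rewrite edge_sym.
apply: (@edge_block _ _ d b (z 0%N) a) => //; first by rewrite edge_sym.
by rewrite zc edge_sym.
Qed.

(** The classes in the image have representatives of known height, from which
    the multiset can be read back at any level. *)
Lemma base_map_height u : exists2 s, base_map u = type_class theta s &
  forall z : Z, height s z = u (z 0%N).
Proof.
pose ok (xi : type_semigroup theta) (u : S -> nat) :=
  exists2 s, xi = type_class theta s & forall z : Z, height s z = u (z 0%N).
have ok0 : ok 0%R (fun=> 0%N) by exists [::] => // z; rewrite /height big_nil.
have okD x y f g : ok x f -> ok y g -> ok (x + y)%R (fun c => f c + g c)%N.
  move=> [s -> sf] [s' -> sg]; exists (s ++ s'); first by rewrite type_class_cat.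
  by move=> z; rewrite /height big_cat /= -sf -sg.
have ok1 a : ok (base_class a) (fun c => (c == a)%N).
  eexists; first by [].
  move=> z; rewrite /height big_seq1 /=; congr nat_of_bool.
  by apply/asboolP/eqP.
have okM n a : ok (base_class a *+ n)%R (fun c => n * (c == a))%N.
  elim: n => [|n IH]; first exact: ok0.
  rewrite mulrS; have [s e sP] := okD _ _ _ _ (ok1 a) IH.
  by exists s => // z; rewrite sP mulSn.
have okS (r : seq S) : ok (\sum_(a <- r) base_class a *+ u a)%R
    (fun c => \sum_(a <- r) u a * (c == a))%N.
  elim: r => [|a r IH].
    by have [s e sP] := ok0; exists s; rewrite ?big_nil // => z; rewrite sP big_nil.
  have [s e sP] := okD _ _ _ _ (okM (u a) a) IH.
  by exists s; rewrite ?big_cons // => z; rewrite sP big_cons.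
have [s e sP] := okS (index_enum S); exists s => // z.
rewrite sP (bigD1 (z 0%N)) //= eqxx muln1 big1 ?addn0 // => a.
by rewrite eq_sym => /negPf ->; rewrite muln0.
Qed.

(** An inequality between classes becomes, at a deep enough level, an inequality
    modulo the congruence of that level, which descends level by level. *)
Lemma base_map_le u v : alg_le (base_map u) (base_map v) ->
  exists v', cgr v (fun c => v' c + u c)%N.
Proof.
have [s -> su] := base_map_height u; have [s' -> sv] := base_map_height v.
move=> [z]; have -> : z = type_class theta (repr z).
  by rewrite /type_class reprK.
rewrite -type_class_cat => /type_classP/equidecomposable_height [n].
move=> h; apply: (@base_descent n u v (fun p => height (repr z) (sample p))).
apply: cgr_ext h => p; last by rewrite sv.
by rewrite /height big_cat /= -/(height s _) su.
Qed.

Lemma base_map_inj u v : base_map u = base_map v -> cgr u v.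
Proof.
have [s -> su] := base_map_height u; have [s' -> sv] := base_map_height v.
move=> /type_classP/equidecomposable_height [n h].
by apply: (@base_inj n); apply: cgr_ext h => p; rewrite ?su ?sv.
Qed.

End TowerSemigroup.

(** * Finite presentations of commutative monoids *)

Section Redei.

(** By induction on the number of coordinates that are free to vary. Given [a]
    in the set, an element not above [a] takes in some free coordinate one of
    the finitely many values below that of [a], and the elements with that value
    there have one free coordinate fewer. *)
Lemma dickson (I : finType) (A : set (I -> nat)) :
  exists2 s : seq (I -> nat), (forall b, b \in s -> A b) &
    forall a, A a -> exists2 b, b \in s & forall i, b i <= a i.
Proof.
suff gen k (F : {set I}) B : #|F| <= k ->
    (forall a b i, B a -> B b -> i \notin F -> a i = b i) ->
    exists2 s : seq (I -> nat), (forall b, b \in s -> B b) &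
      forall a, B a -> exists2 b, b \in s & forall i, b i <= a i.
  by apply: (gen #|I| [set: I]%SET); rewrite ?cardsT // => a b i; rewrite inE.
elim: k F B => [|k IH] F B Fk BF.
  have [[a Ba]|no] := pselect (exists a, B a); last first.
    by exists [::] => // a Ba; case: no; exists a.
  exists [:: a] => [b|b Bb]; first by rewrite inE => /eqP ->.
  exists a; first by rewrite inE.
  move=> i; rewrite (BF a b) //; move: Fk; rewrite leqn0 cards_eq0 => /eqP ->.
  by rewrite inE.
have [[a Ba]|no] := pselect (exists a, B a); last first.
  by exists [::] => // a Ba; case: no; exists a.
have slice i c : exists s : seq (I -> nat), i \in F ->
    (forall b, b \in s -> B b /\ b i = c) /\
    forall b, B b -> b i = c -> exists2 b', b' \in s & forall j, b' j <= b j.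
  have [iF|_] := boolP (i \in F); last by exists [::].
  have [||s sB sb] := IH (F :\ i) (fun b => B b /\ b i = c).
  - by move: Fk; rewrite (cardsD1 i) iF; lia.
  - move=> b b' j [Bb bi] [Bb' bi']; rewrite !inE negb_and negbK.
    by move=> /orP[/eqP ->|]; [rewrite bi|exact: BF].
  by exists s => _; split=> // b Bb bi; exact: sb.
pose t i c := projT1 (cid (slice i c)).
have tP i c : i \in F -> (forall b, b \in t i c -> B b /\ b i = c) /\
    forall b, B b -> b i = c -> exists2 b', b' \in t i c & forall j, b' j <= b j.
  by rewrite /t; case: cid.
exists (a :: flatten [seq flatten [seq t i c | c <- iota 0 (a i)] | i <- enum F]).
  move=> b; rewrite inE => /predU1P[->//|/flattenP[r /mapP[i]]].
  rewrite mem_enum => iF -> /flattenP[q /mapP[c _ ->]] bt.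
  by have [/(_ b bt) []] := tP i c iF.
move=> b Bb; have [/forallP ab|] := boolP [forall i, a i <= b i].
  by exists a; rewrite ?inE ?eqxx.
rewrite negb_forall => /existsP[i]; rewrite -ltnNge => bai.
have iF : i \in F.
  by apply: contraT => iF; move: bai; rewrite (BF a b i) // ltnn.
have [_ /(_ b Bb erefl) [b' b't b'b]] := tP i (b i) iF.
exists b' => //; rewrite inE; apply/orP; right.
apply/flattenP; eexists; first by apply: map_f; rewrite mem_enum; exact: iF.
by apply/flattenP; eexists; first by apply: map_f; rewrite mem_iota; exact: bai.
Qed.

Variable n : nat.
Implicit Types (u v w : 'I_n -> nat) (R Q : ('I_n -> nat) -> ('I_n -> nat) -> Prop).

Definition additive_congruence R := [/\ forall u, R u u, forall u v, R u v -> R v u,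
  forall u v w, R u v -> R v w -> R u w &
  forall w u v, R u v -> R (fun i => u i + w i) (fun i => v i + w i)].

Definition lex u v := exists2 i : 'I_n,
  forall j : 'I_n, j < i -> u j = v j & u i < v i.

Lemma lex_asym u v : lex u v -> lex v u -> False.
Proof.
move=> [i ei li] [j ej lj]; case: (ltngtP i j) => ij.
- by move: li; rewrite (ej _ ij) ltnn.
- by move: lj; rewrite (ei _ ij) ltnn.
- by move: lj; rewrite -(ord_inj ij); lia.
Qed.

Lemma lex_add w u v : lex u v -> lex (fun i => u i + w i) (fun i => v i + w i).
Proof.
by move=> [i ei li]; exists i => [j /ei ->//|]; rewrite ltn_add2r.
Qed.

(** Minimise the coordinates one after the other. *)
Lemma lex_min (A : set ('I_n -> nat)) u : A u ->
  exists2 m, A m & forall a, A a -> a = m \/ lex m a.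
Proof.
move=> Au.
suff agree k : exists2 m, A m & forall a, A a ->
    (forall j : 'I_n, j < k -> a j = m j) \/
    exists2 i : 'I_n, i < k & (forall j : 'I_n, j < i -> m j = a j) /\ m i < a i.
  have [m Am mP] := agree n.
  exists m => // a /mP [am|[i _ [ei li]]]; [left|by right; exists i].
  by apply/funext => j; exact: am.
elim: k => [|k [m Am mP]]; first by exists u => // a _; left.
have [kn|nk] := ltnP k n; last first.
  exists m => // a /mP [am|[i ik [ei li]]].
    by left=> j _; apply: am; apply: leq_trans nk.
  by right; exists i => //; exact: ltnW.
pose P c := `[< exists2 a, A a &
  (forall j : 'I_n, j < k -> a j = m j) /\ a (Ordinal kn) = c >].
have exP : exists c, P c by exists (m (Ordinal kn)); apply/asboolP; exists m.
case: (ex_minnP exP) => c /asboolP [a Aa [am ac]] cmin.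
exists a => // b Ab; case: (mP b Ab) => [bm|[i ik [ei li]]]; last first.
  right; exists i; first exact: ltnW.
  split=> [j ji|]; last by rewrite am.
  by rewrite am ?ei //; exact: ltn_trans ji ik.
have cb : c <= b (Ordinal kn).
  by apply: cmin; apply/asboolP; exists b.
have [e|lt] := eqVneq c (b (Ordinal kn)).
  left => j; rewrite ltnS leq_eqVlt => /orP[/eqP jk|jk]; last by rewrite bm ?am.
  by rewrite (_ : j = Ordinal kn) ?ac //; exact: ord_inj.
right; exists (Ordinal kn) => //; split=> [j jk|]; first by rewrite am ?bm.
by rewrite ac ltn_neqAle lt.
Qed.

(** Commutative congruences are finitely generated: the elements that are not
    lexicographically least in their class form an ideal since the order is
    compatible with addition. Let [s] be a finite basis of it and pair each [b]
    in [s] with a smaller equivalent element. These pairs suffice to rewrite any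
    element into the least element of its class. *)
Lemma redei R : additive_congruence R ->
  exists2 L : seq (('I_n -> nat) * ('I_n -> nat)),
    (forall p, p \in L -> R p.1 p.2) &
    forall Q, additive_congruence Q -> (forall p, p \in L -> Q p.1 p.2) ->
      forall u v, R u v -> Q u v.
Proof.
move=> [Rr Rs Rt Ra].
(* [X] is the ideal of the elements that can be lowered. *)
pose X u := exists w, R u w /\ lex w u.
have [s sX Xs] := dickson X.
have low b : exists w, b \in s -> R b w /\ lex w b.
  have [bs|_] := boolP (b \in s); last by exists b.
  by have [w bw] := sX b bs; exists w.
pose t b := projT1 (cid (low b)).
have tP b : b \in s -> R b (t b) /\ lex (t b) b by rewrite /t; case: cid.
exists [seq (b, t b) | b <- s].
  by move=> _ /mapP[b bs ->] /=; case: (tP b bs).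
move=> Q [Qr Qs Qt Qa] LQ u v uv.
have norm w : exists m, [/\ Q w m, R w m & ~ X m].
  have [|m [Qm Rm] mP] := @lex_min (fun m => Q w m /\ R w m) w; first by split.
  exists m; split=> // /Xs [b bs bm].
  have [Rb lb] := tP b bs.
  have mE : m = fun i => b i + (m i - b i).
    by apply/funext => i; rewrite subnKC.
  pose m' i := t b i + (m i - b i).
  have lm : lex m' m by rewrite mE; exact: lex_add.
  have [|mm|/(lex_asym lm)//] := mP m'.
    split; [apply: (Qt _ _ _ Qm)|apply: (Rt _ _ _ Rm)]; rewrite mE.
      by apply: Qa; exact: (LQ (b, t b) (map_f _ bs)).
    exact: Ra.
  by move: lm; rewrite mm => lmm; exact: (lex_asym lmm lmm).
have [mu [Qu Ru nXu]] := norm u; have [mv [Qv Rv nXv]] := norm v.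
suff e : mu = mv by rewrite -e in Qv; exact: (Qt _ _ _ Qu (Qs _ _ Qv)).
have Rm : R mu mv := Rt _ _ _ (Rs _ _ Ru) (Rt _ _ _ uv Rv).
have [|m mP mm] := @lex_min (fun m => m = mu \/ m = mv) mu; first by left.
case: (mm mu) => [|um|lu]; first by left.
  case: (mm mv) => [|vm|lv]; [by right|by rewrite um vm|].
  by case: nXv; exists mu; split; [exact: Rs|rewrite um].
case: mP => e; rewrite e in lu; first by case: (lex_asym lu lu).
by case: nXu; exists mv.
Qed.

End Redei.

Section Presentation.
Variables (M : nmodType) (n : nat) (v : 'I_n -> M).
Hypothesis conM : conical M.
Hypothesis v_neq0 : forall i, v i != 0%R.

Definition combine (x : 'I_n -> nat) : M := (\sum_i v i *+ x i)%R.

Lemma combineD x y :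
  combine (fun i => x i + y i)%N = (combine x + combine y)%R.
Proof. by rewrite -big_split; apply: eq_bigr => i _; rewrite mulrnDr. Qed.

Lemma combine_eq0 x i : combine x = 0%R -> x i = 0%N.
Proof.
rewrite /combine (bigD1 i) //= => /conM [+ _].
case: (x i) => [//|k]; rewrite mulrS => /conM [vi _].
by have := v_neq0 i; rewrite vi eqxx.
Qed.

(** A nontrivial combination of nonzero generators of a conical monoid is not
    zero. Hence the two sides of a relation are empty together, so that every
    block has a nonempty partner. *)
Lemma combine_support x y i : combine x = combine y -> 0 < x i ->
  exists j, 0 < y j.
Proof.
move=> xy xi; apply: contrapT => /forallNP no.
have : combine x = 0%R.
  rewrite xy /combine big1 // => j _.
  by have /negP := no j; rewrite -eqn0Ngt => /eqP ->.
by move=> /(@combine_eq0 x i) x0; rewrite x0 in xi.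
Qed.

Variables (J : finType) (lhs rhs : J -> 'I_n -> nat) (c : nat).
Hypothesis balanceP : forall j, combine (lhs j) = combine (rhs j).
Hypothesis boundP : forall j i, lhs j i + rhs j i <= c.

(** Each generator of the monoid comes in [c.+1] copies, made equal by the
    involutions [inl e] that exchange copies [0] and [e]. There is then room to
    read off the two sides of each relation [j] as disjoint sets of letters,
    the first [lhs j i] copies of the generator [i] and the next [rhs j i] ones,
    which the involution [inr j] exchanges as blocks. *)
Local Notation alphabet := ('I_n * 'I_c.+1)%type.
Local Notation rels := ('I_c.+1 + J)%type.
Implicit Types (a b : alphabet) (d : rels).

Definition side d a : alphabet + bool :=
  match d with
  | inl _ => inl a
  | inr j => if a.2 < lhs j a.1 then inr true
             else if a.2 < lhs j a.1 + rhs j a.1 then inr false else inl a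
  end.

Definition swap_side d (t : alphabet + bool) : alphabet + bool :=
  match d, t with
  | inl e, inl a => inl (a.1, tperm ord0 e a.2)
  | inr _, inr s => inr (~~ s)
  | _, _ => t
  end.

Lemma swap_sideK d : involutive (swap_side d).
Proof.
by case: d => [e|j] [[i k]|s] //=; rewrite ?tpermK ?negbK.
Qed.

(** Matching along a labelling by [side] and an involution of the labels makes
    symmetry and the block property automatic. *)
Definition pres_edge d : rel alphabet := fun a b => side d a == swap_side d (side d b).

Lemma pres_edge_sym d : symmetric (pres_edge d).
Proof.
by move=> a b; rewrite /pres_edge -[RHS](inj_eq (can_inj (swap_sideK d))) swap_sideK eq_sym.
Qed.

Lemma pres_edge_block d a a' b b' :
  pres_edge d a b -> pres_edge d a' b -> pres_edge d a' b' -> pres_edge d a b'.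
Proof.
by rewrite /pres_edge => /eqP -> /eqP <- /eqP ->.
Qed.

Lemma lhs_side j i : 0 < lhs j i -> side (inr j) (i, ord0) = inr true.
Proof. by move=> /= ->. Qed.

Lemma rhs_side j i : 0 < rhs j i -> exists k, side (inr j) (i, k) = inr false.
Proof.
move=> ri; have lc : lhs j i < c.+1 by have := boundP j i; lia.
exists (Ordinal lc) => /=; rewrite ltnn.
by rewrite -[X in (X < _)%N]addn0 ltn_add2l ri.
Qed.

Lemma side_inr j a s : side (inr j) a = inr s ->
  if s then 0 < lhs j a.1 else 0 < rhs j a.1.
Proof.
move=> /=; case: ltnP => [al [<-]|la]; first by apply: leq_ltn_trans al.
by case: ltnP => // ar [<-]; lia.
Qed.

Lemma pres_edge_total d a : exists b, pres_edge d a b.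
Proof.
rewrite /pres_edge; case: d => [e|j].
  by exists (a.1, tperm ord0 e a.2); rewrite /= tpermK; case: (a).
case E: (side (inr j) a) => [b|s].
  exists a; rewrite E; apply/eqP; move: E => /=.
  by case: ifP => // _; case: ifP => // _ [->].
have := side_inr E; case: s {E} => [l0|r0].
  have [i /rhs_side [k ki]] := combine_support (balanceP j) l0.
  by exists (i, k); rewrite ki.
have [i /lhs_side ki] := combine_support (esym (balanceP j)) r0.
by exists (i, ord0); rewrite ki.
Qed.

Definition pres_system : pairing_system rels :=
  PairingSystem pres_edge_sym pres_edge_block pres_edge_total.

Definition value (u : alphabet -> nat) : M := (\sum_a v a.1 *+ u a)%R.

Definition collapse (u : alphabet -> nat) (i : 'I_n) : nat := \sum_k u (i, k).

Definition embed (x : 'I_n -> nat) (a : alphabet) : nat := x a.1 * (a.2 == ord0).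

Lemma valueD u w : value (fun a => u a + w a)%N = (value u + value w)%R.
Proof. by rewrite -big_split; apply: eq_bigr => i _; rewrite mulrnDr. Qed.

Lemma value_collapse u : value u = combine (collapse u).
Proof.
rewrite /value /combine /collapse.
under [RHS]eq_bigr do rewrite -sumrMnr.
by rewrite pair_bigA; apply: eq_bigr => -[i k].
Qed.

Lemma collapse_embed x : collapse (embed x) = x.
Proof.
apply/funext => i; rewrite /collapse (bigD1 ord0) //= /embed eqxx muln1.
by rewrite big1 ?addn0 // => k /negPf /= ->; rewrite muln0.
Qed.

Lemma sum_ltn N m : \sum_(k < N) (k < m) = minn N m.
Proof.
elim: N => [|N IH]; first by rewrite big_ord0 min0n.
by rewrite big_ord_recr /= IH; lia.
Qed.

Lemma collapse_lhs j : collapse (fun a => side (inr j) a == inr true) = lhs j.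
Proof.
apply/funext => i; rewrite /collapse.
rewrite (eq_bigr (fun k : 'I_c.+1 => (k < lhs j i) : nat)) => [|k _ /=].
  by rewrite sum_ltn; have := boundP j i; lia.
by case: ifP => //; case: ifP.
Qed.

Lemma collapse_rhs j : collapse (fun a => side (inr j) a == inr false) = rhs j.
Proof.
apply/funext => i.
suff : collapse (fun a => side (inr j) a == inr false) i + lhs j i =
       lhs j i + rhs j i by lia.
rewrite -{1}collapse_lhs /collapse -big_split /=.
rewrite (eq_bigr (fun k : 'I_c.+1 => (k < lhs j i + rhs j i) : nat)) => [|k _ /=].
  by rewrite sum_ltn; have := boundP j i; lia.
by case: ltnP => kl; case: ltnP => kr //; lia.
Qed.

Lemma value_side_swap d t :
  value (fun a => side d a == t) = value (fun a => side d a == swap_side d t).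
Proof.
case: d t => [e|j] [a|s] //.
  have one b : value (fun a => side (inl e) a == inl b) = v b.1.
    rewrite /value (bigD1 b) //= eqxx big1 ?addr0 // => a' /negPf ab.
    by rewrite (inj_eq (@inl_inj _ _)) ab.
  by rewrite !one.
by rewrite !value_collapse; case: s; rewrite /= ?collapse_lhs ?collapse_rhs balanceP.
Qed.

Lemma cgr_value u w : cgr (S := pres_system) u w -> value u = value w.
Proof.
elim=> [//|{}w d a b ab _ ->]; rewrite !valueD; congr (_ + _)%R.
have E x : value (fun a => edge (p := pres_system) d x a) = value (fun a => side d a == side d x).
  rewrite value_side_swap; congr value; apply/funext => y; congr nat_of_bool.
  by rewrite /= pres_edge_sym.
by rewrite !E value_side_swap; move/eqP: ab => ->; rewrite swap_sideK.
Qed.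

(** All copies of a generator can be replaced by its copy [0]. *)
Lemma cgr_collapse u : cgr (S := pres_system) u (embed (collapse u)).
Proof.
have one (a : alphabet) : cgr (S := pres_system) (fun b => b == a) (fun b => b == (a.1, ord0)).
  have E x : (fun b => 0 + edge (p := pres_system) (inl a.2) x b)%N =
     (fun b => b == (x.1, tperm ord0 a.2 x.2) : nat).
    apply/funext => b; rewrite add0n /= pres_edge_sym /pres_edge /=.
    by rewrite (inj_eq (@inl_inj _ _)).
  have := @cgr_step _ pres_system (fun b => b == a) (fun=> 0%N) (inl a.2) (a.1, ord0) a.
  rewrite !E /= tpermL tpermR -surjective_pairing; apply; last exact: cgr_refl.
  by rewrite /pres_edge /= tpermR.
apply: (@cgr_ext _ pres_system (fun b => \sum_a u a * (b == a)) _
                              (fun b => \sum_a u a * (b == (a.1, ord0)))).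
- move=> b; rewrite (bigD1 b) //= eqxx muln1 big1 ?addn0 // => a.
  by rewrite eq_sym => /negPf ->; rewrite muln0.
- move=> [i k]; rewrite /embed /collapse /= big_distrl /=.
  transitivity (\sum_i' \sum_k' u (i', k') * ((i, k) == (i', ord0))).
    by rewrite pair_bigA; apply: eq_bigr => -[].
  rewrite (bigD1 i) //= [X in _ + X]big1 ?addn0 => [|i' ii'].
    by apply: eq_bigr => k' _; rewrite xpair_eqE eqxx.
  by apply: big1 => k' _; rewrite xpair_eqE eq_sym (negPf ii') muln0.
- by apply: cgr_sum => a _; apply: cgr_muln; exact: one.
Qed.

(** The two sides of relation [j] are what remains, once copies are forgotten, of
    two partner blocks for [inr j]. *)
Lemma cgr_relation j :
  cgr (S := pres_system) (embed (lhs j)) (embed (rhs j)).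
Proof.
rewrite -{1}collapse_lhs -{1}collapse_rhs.
apply: (@cgr_trans _ pres_system (fun a => side (inr j) a == inr true)).
  by apply: cgr_sym; exact: cgr_collapse.
apply: cgr_trans (cgr_collapse _).
have edgeE x s : side (inr j) x = inr s -> (fun y => 0 + edge (p := pres_system) (inr j) x y) =
    (fun y => side (inr j) y == inr (~~ s) : nat).
  move=> xs; apply/funext => y; rewrite add0n /= pres_edge_sym /pres_edge.
  by rewrite xs.
have [[a aL]|no] := pselect (exists a, side (inr j) a = inr true).
  have [b] := pres_edge_total (inr j) a; rewrite /pres_edge aL => /eqP bR.
  have {}bR : side (inr j) b = inr false.
    by apply: (can_inj (swap_sideK (inr j))); rewrite -bR.
  have := @cgr_step _ pres_system (fun y => side (inr j) y == inr true) (fun=> 0) (inr j) b a.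
  rewrite (edgeE _ _ aL) (edgeE _ _ bR) /=; apply; last exact: cgr_refl.
  by rewrite /pres_edge aL bR.
have no' a : side (inr j) a <> inr false.
  move=> aR; apply: no; have [b] := pres_edge_total (inr j) a.
  rewrite /pres_edge aR => /eqP bL; exists b.
  by apply: (can_inj (swap_sideK (inr j))); rewrite -bL.
apply: cgr_ext (cgr_refl _) => // a.
rewrite (_ : (_ == inr true) = false); last by apply/eqP => aL; apply: no; exists a.
by apply/esym/eqP; rewrite eqb0; apply/eqP; exact: no'.
Qed.

Lemma embed_congruence :
  additive_congruence (fun x y => cgr (S := pres_system) (embed x) (embed y)).
Proof.
split=> [x|x y|x y z|z x y].
- exact: cgr_refl.
- exact: cgr_sym.
- exact: cgr_trans.
- move=> /(@cgr_addr _ pres_system (embed z)); apply: cgr_ext => a;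
    by rewrite /embed mulnDl.
Qed.

Hypothesis presP : forall Q, additive_congruence Q -> (forall j, Q (lhs j) (rhs j)) ->
  forall x y, combine x = combine y -> Q x y.

Lemma value_cgr u w : value u = value w -> cgr (S := pres_system) u w.
Proof.
rewrite !value_collapse => /(presP embed_congruence cgr_relation) uw.
apply: (cgr_trans (cgr_collapse u)); apply: (cgr_trans uw).
by apply: cgr_sym; exact: cgr_collapse.
Qed.

Lemma value_embed x : value (embed x) = combine x.
Proof. by rewrite value_collapse collapse_embed. Qed.

End Presentation.

(** Generators equal to zero are discarded beforehand, since a relation between
    such generators and the empty sum would match a nonempty block with an empty
    one. *)
Lemma pairing_presentation (M : nmodType) : finitely_generated M -> conical M ->
  exists (D : finType) (d0 : D) (S : pairing_system D) (value : (S -> nat) -> M),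
  [/\ forall u w, value (fun a => u a + w a)%N = (value u + value w)%R,
      forall m, exists u, value u = m &
      forall u w, cgr u w <-> value u = value w].
Proof.
move=> [s sM] conM.
pose s' := [seq x <- s | x != 0%R]; pose n := size s'.
pose v (i : 'I_n) := (s'`_i)%R.
have v0 i : v i != 0%R.
  by have := mem_nth 0%R (ltn_ord i); rewrite mem_filter => /andP[].
have genM m : exists x, combine v x = m.
  have g0 : exists x, combine v x = 0%R.
    by exists (fun=> 0%N); rewrite /combine big1 // => i _; rewrite mulr0n.
  have gD a b : (exists x, combine v x = a) -> (exists x, combine v x = b) ->
      exists x, combine v x = (a + b)%R.
    by move=> [x <-] [y <-]; eexists; exact: combineD.
  have g1 (i : 'I_(size s)) : exists x, combine v x = (s`_i)%R.
    have [->//|si] := eqVneq (s`_i)%R 0%R.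
    have sis' : (s`_i)%R \in s' by rewrite mem_filter si mem_nth.
    have lt : index (s`_i)%R s' < n by rewrite index_mem.
    exists (fun j => j == Ordinal lt); rewrite /combine (bigD1 (Ordinal lt)) //=.
    rewrite eqxx mulr1n big1 ?addr0 ?/v /= ?nth_index // => j /negPf ->.
    by rewrite mulr0n.
  have [k ->] := sM m; apply: (big_ind (fun m => exists x, combine v x = m)) => //.
  move=> i _; elim: (k i) => [|q IH]; first by rewrite mulr0n.
  by rewrite mulrS; exact: gD.
have [|L LR LQ] := @redei n (fun x y => combine v x = combine v y).
  split=> [//|x y ->//|x y z -> //|z x y xy].
  by rewrite !combineD xy.
pose p (j : 'I_(size L)) := nth (fun=> 0, fun=> 0) L j.
have pL j : p j \in L by exact: mem_nth.
pose lhs j := (p j).1; pose rhs j := (p j).2.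
pose c := \sum_j \sum_i (lhs j i + rhs j i).
have bal j : combine v (lhs j) = combine v (rhs j) by exact: LR.
have bnd j i : lhs j i + rhs j i <= c.
  by rewrite /c (bigD1 j) //= (bigD1 i) //=; lia.
have pres Q : additive_congruence Q -> (forall j, Q (lhs j) (rhs j)) ->
    forall x y, combine v x = combine v y -> Q x y.
  move=> Qc Qj; apply: LQ => // q /(nthP (fun=> 0, fun=> 0)) [j jL <-].
  exact: (Qj (Ordinal jL)).
exists ('I_c.+1 + 'I_(size L))%type, (inl ord0).
exists (pres_system conM v0 bal bnd), (value v (c := c)); split.
- exact: valueD.
- by move=> m; have [x <-] := genM m; exists (embed x); exact: value_embed.
- by move=> u w; split; [exact: cgr_value|exact: value_cgr].
Qed.

(** * The embedding *)

Local Open Scope ring_scope.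

Theorem theorem7p11 (R : realType) (M : nmodType) :
  finitely_generated M -> conical M ->
  exists Z : metricType R,
    [/\ compact [set: Z], zero_dimensional Z &
      exists (F : groupType) (theta : homeo_action F Z)
             (iota : {additive M -> type_semigroup theta}),
        fg_free_group F /\ order_embedding iota].
Proof.
move=> fgM conM.
have [D [d0 [S [value [valueD value_surj valueP]]]]] := pairing_presentation fgM conM.
exists (tower_limit S R); split.
- exact: limit_compact.
- exact: limit_zero_dimensional.
exists (free_group D), (free_action (@flipK D S R) (@flip_continuous D S R)).
pose rep m := projT1 (cid (value_surj m)).
have repP m : value (rep m) = m by rewrite /rep; case: cid.
pose iota m := base_map R (rep m).
have iotaE u : base_map R u = iota (value u).
  by apply: base_map_cgr; apply/valueP; rewrite repP.
have value0 : value (fun=> 0%N) = 0%R.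
  have [u u0] := value_surj 0%R.
  rewrite -[LHS]addr0 -u0 -valueD.
  by congr value; apply/funext.
have iota0 : iota 0%R = 0%R.
  rewrite -value0 -iotaE /base_map big1 // => a _; exact: mulr0n.
have iotaD : {morph iota : x y / (x + y)%R}.
  by move=> x y; rewrite -{1}(repP x) -{1}(repP y) -valueD -iotaE base_mapD.
pose iota' : {additive M -> _} :=
  HB.pack iota (GRing.isNmodMorphism.Build _ _ iota (conj iota0 iotaD)).
exists iota'; split; first exact: free_group_fg.
split=> [x y /(base_map_inj d0)/valueP|x y]; first by rewrite !repP.
split=> [/(base_map_le d0) [w /valueP]|[z <-]].
  by rewrite valueD !repP => ->; exists (value w); rewrite addrC.
by exists (iota' z); rewrite -raddfD.
Qed.
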